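(* Under full information feedback, when $v_1,\dots,v_T$ are sampled i.i.d. from some distribution $F$ on $[0,\bar v]$, there is a constant $C$ such that with probability at least $1-4/T$, the OGD-CB algorithm $\beta$ guarantees \[\mathrm{OPT}-R^\beta(\bm v,\bm p)\le C\sqrt{T\ln T}.\]
   Context: Model: constants $\bar v>0$, $\rho\in(0,\bar v]$; $T$ rounds; budget $B=\rho T$. In round $t$ the buyer has value $v_t\in[0,\bar v]$; highest competing bid $p_t$ i.i.d. from an unknown distribution $G$ on $[0,\bar v]$, independent of the values. Buyer chooses $x_t\in\{0,1\}$, receives $x_tr_t$ with $r_t=(v_t-p_t)^+$ and pays $x_tc_t$ with $c_t=p_t\mathbf 1[v_t\ge p_t]$. Full information feedback: $p_t$ is observed at the end of every round; partial information feedback: $p_t$ is observed only if $x_t=1$. Revenue $R^\beta(\bm v,\bm p)=\sum_{t=1}^{T_0}x_tr_t$, $T_0$ the ending time. Fluid benchmark: $\mathrm{OPT}=T\max_{\pi:[0,\bar v]\to[0,1]}\mathbb E_{v\sim F,p\sim G}[\pi(v)(v-p)^+]$ s.t. $\mathbb E_{v\sim F,p\sim G}[\pi(v)p\mathbf 1[v\ge p]]\le\rho$. OGD-CB algorithm: initialize $\mathcal I_1=\emptyset$, $B_1=B$, $\lambda_1=0$. For $t=1,\dots,T$: observe $v_t$. If $t=1$: $x_1=1$, $\lambda_2=\lambda_1$. Otherwise: $\epsilon_t=\sqrt{(\ln 2+2\ln T)/(2|\mathcal I_t|)}$; $\tilde r_t(v)=\frac1{|\mathcal I_t|}\sum_{\tau\in\mathcal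 I_t}(v-p_\tau)^++\epsilon_tv$; $\tilde c_t(v)=\frac1{|\mathcal I_t|}\sum_{\tau\in\mathcal I_t}p_\tau\mathbf 1[v\ge p_\tau]-2\epsilon_tv$; $x_t=\mathbf 1[\tilde r_t(v_t)\ge\lambda_t\tilde c_t(v_t)]$; $\eta_t=1/(\bar v\sqrt t)$; $\lambda_{t+1}=(\lambda_t+\eta_t(x_t\tilde c_t(v_t)-\rho))^+$. Then if (full information) or (partial information and $x_t=1$), observe $p_t$ and set $\mathcal I_{t+1}=\mathcal I_t\cup\{t\}$, else $\mathcal I_{t+1}=\mathcal I_t$. Set $B_{t+1}=B_t-x_tc_t$; if $B_{t+1}<\bar v$, stop. $T_0$ is the round at which the algorithm stops (or $T$). *)

(* Defs.v *)
From HB Require Import structures.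
From mathcomp Require Import all_boot all_order all_algebra.
From mathcomp Require Import all_classical all_reals all_analysis.
Set Implicit Arguments.
Unset Strict Implicit.
Unset Printing Implicit Defensive.
Import Order.TTheory GRing.Theory Num.Theory.
Import numFieldNormedType.Exports.
Local Open Scope classical_set_scope.
Local Open Scope ring_scope.

Section OGDCB.
Variable R : realType.

Definition pos_part (x : R) : R := Num.max x 0.

Definition rwd (v p : R) : R := pos_part (v - p).
Definition cst (v p : R) : R := if p <= v then p else 0.

(* state of OGD-CB after some rounds:
   lambda_t, remaining budget B_t, observed competing bids {p_tau : tau in I_t},
   accumulated revenue, and whether the algorithm has stopped *)
Record ogd_state := OgdState {
  st_lam : R; st_bud : R; st_obs : seq R; st_rev : R; st_stop : bool }.

Definition mean (f : R -> R) (s : seq R) : R :=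
  (\sum_(q <- s) f q) / (size s)%:R.

Definition ogd_step (full : bool) (vbar rho : R) (T t : nat) (v p : R)
    (s : ogd_state) : ogd_state :=
  if st_stop s then s else
  let: (x, lam') :=
    if t == 1%N then (true, st_lam s) else
    let n := size (st_obs s) in
    let eps := Num.sqrt ((ln 2 + 2 * ln (T%:R)) / (2 * n%:R)) in
    let rt := mean (fun q => rwd v q) (st_obs s) + eps * v in
    let ct := mean (fun q => cst v q) (st_obs s) - 2 * eps * v in
    let x := st_lam s * ct <= rt in
    let eta := 1 / (vbar * Num.sqrt (t%:R)) in
    (x, Num.max (st_lam s + eta * ((x%:R) * ct - rho)) 0) in
  let obs' := if full || x then rcons (st_obs s) p else st_obs s in
  let bud' := st_bud s - (x%:R) * cst v p in
  let rev' := st_rev s + (x%:R) * rwd v p in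
  OgdState lam' bud' obs' rev' (bud' < vbar).

Fixpoint ogd_run (full : bool) (vbar rho : R) (T : nat) (v p : nat -> R)
    (n : nat) : ogd_state :=
  match n with
  | 0 => OgdState 0 (rho * T%:R) [::] 0 false
  | n'.+1 => ogd_step full vbar rho T n'.+1 (v n'.+1) (p n'.+1)
                (ogd_run full vbar rho T v p n')
  end.

Definition ogd_revenue (full : bool) (vbar rho : R) (T : nat) (v p : nat -> R)
  : R := st_rev (ogd_run full vbar rho T v p T).

Definition fluid_opt (vbar rho : R) (T : nat)
    (F G : probability R R) : \bar R :=
  ((T%:R)%:E * ereal_sup
    [set (\int[F]_v ((pol v)%:E * \int[G]_p (rwd v p)%:E))%E
      | pol in [set pol : R -> R | measurable_fun setT pol
          /\ (forall v, (0 <= pol v <= 1)%R)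
          /\ (\int[F]_v ((pol v)%:E * \int[G]_p (cst v p)%:E) <= rho%:E)%E]])%E.

Definition mutually_indep (d : measure_display) (Omega : measurableType d)
    (I : finType) (P : probability Omega R) (X : I -> Omega -> R) : Prop :=
  forall B : I -> set R, (forall i, measurable (B i)) ->
    P (\bigcap_(i in [set: I]) (X i @^-1` B i)) =
    (\prod_(i : I) P (X i @^-1` B i))%E.

Definition has_law (d : measure_display) (Omega : measurableType d)
    (P : probability Omega R) (X : Omega -> R) (mu : probability R R) : Prop :=
  forall B : set R, measurable B -> P (X @^-1` B) = mu B.

End OGDCB.

(* Main.v *)
Require Import Defs.
From HB Require Import structures.
From mathcomp Require Import all_boot all_order all_algebra.
From mathcomp Require Import all_classical all_reals all_analysis.
From mathcomp Require Import measurable_realfun ring lra.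
Import Order.TTheory GRing.Theory Num.Theory.
Import numFieldNormedType.Exports.
Local Open Scope classical_set_scope.
Local Open Scope ring_scope.
Set Implicit Arguments.
Unset Strict Implicit.
Unset Printing Implicit Defensive.

(* Pathwise, in every active round the choice of x_t maximises
   x (reward_ucb t - lam_t * cost_lcb t), so it does at least as well as any fixed
   policy pol; the term lam_t (rho - x_t * cost_lcb t) is compared with
   u (rho - x_t * cost_lcb t) by the potential (lam_t - u)^2 of projected gradient
   descent.  This is applied with u = 0 if the budget lasts, and with
   u = vbar / rho if it is exhausted: the spent budget then pays vbar for each
   round that is not played.  The multiplier never exceeds 3/2 * vbar/rho + 1.
   What remains are sums of bounded martingale differences of three kinds:
   the estimation errors of round t (reveal all values first, then the bids one
   by one), the differences between realised and mean rewards and payments (same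
   order), and the fluctuation of the policy along the values (reveal all bids
   first).  Azuma's inequality bounds each of at most 4T of them with failure
   probability T^-3.  Since the good event may not depend on the policy, pol is
   fixed beforehand as 1/T-optimal for the fluid benchmark. *)

(** * Pathwise regret analysis *)

(** One step of projected online gradient descent with step size [1 / (vbar * s)]; in use [s] is the
    square root of the round. The slack [delta] is there because a lower confidence bound on a cost
    can be negative: the gradient may then exceed [vbar] by [delta], and this excess is multiplied
    by a decrease of the multiplier, hence the term [Lam * delta]. *)
Lemma dual_step_regret (R : realType) (vbar rho lam lam' u Lam s delta ct : R)
    (x : bool) :
  0 < vbar -> 0 < s -> 0 <= rho <= vbar -> 0 <= lam <= Lam -> 0 <= u -> 0 <= delta ->
  - delta <= ct <= vbar ->
  lam' = Num.max (lam + 1 / (vbar * s) * (x%:R * ct - rho)) 0 ->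
  lam * (rho - x%:R * ct) <= u * (rho - x%:R * ct)
    + vbar / 2 * s * ((lam - u) ^+ 2 - (lam' - u) ^+ 2)
    + vbar / 2 / s + Lam * delta.
Proof.
move=> vbar0 s0 /andP[rho0 rhov] /andP[lam0 lamL] u0 delta0 /andP[ctl ctu] lam'E.
set g := rho - x%:R * ct.
have gl : - vbar <= g.
  by rewrite /g; case: x {lam'E g} => /=; nra.
have gu : g <= vbar + delta.
  by rewrite /g; case: x {lam'E g gl} => /=; nra.
have vs0 : 0 < vbar * s by rewrite mulr_gt0.
set d := lam - lam'.
have lam'0 : 0 <= lam' by rewrite lam'E le_max lexx orbT.
have dL : d <= Lam by rewrite /d; lra.
(* [lam'] is the projection of [lam - g / (vbar * s)] on the half-line, and u is
   a point of it. *)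
have three_point : (vbar * s * d - g) * (lam' - u) >= 0.
  have e : lam + 1 / (vbar * s) * (x%:R * ct - rho) = lam - g / (vbar * s).
    by rewrite /g; ring.
  move: lam'E; rewrite e /Num.max; case: ifP => h l'.
    have : lam * (vbar * s) < g.
      by rewrite -ltr_pdivlMr //; lra.
    rewrite /d l' => h2; nra.
  have -> : vbar * s * d - g = 0.
    by rewrite /d l'; field; rewrite !gt_eqF.
  by rewrite mul0r.
(* Young's inequality handles gradients of size at most [vbar]. If [g] is larger, it is applied to
   [vbar] itself, and the excess costs at most [delta * d] when [d >= 0]. *)
have gd : g * d <= vbar / 2 * s * d ^+ 2 + vbar / 2 / s + Lam * delta.
  have key (h : R) : - vbar <= h <= vbar -> h * d <= vbar / 2 * s * d ^+ 2 + vbar / 2 / s.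
    move=> /andP[h1 h2].
    have : 0 <= vbar / 2 / s * (s * d - h / vbar) ^+ 2.
      by rewrite mulr_ge0 ?sqr_ge0 // !mulr_ge0 ?invr_ge0 ?ltW.
    have -> : vbar / 2 / s * (s * d - h / vbar) ^+ 2
       = vbar / 2 * s * d ^+ 2 - h * d + (h ^+ 2 / vbar) / 2 / s.
      by field; rewrite !gt_eqF.
    have : (h ^+ 2 / vbar) / 2 / s <= vbar / 2 / s.
      rewrite ler_pM2r ?invr_gt0 // ler_pM2r ?invr_gt0 // ler_pdivrMr //.
      by rewrite -subr_ge0; nra.
    lra.
  have [gv|gv] := leP g vbar.
    have := key g; rewrite gl gv => /(_ isT); nra.
  have vv : - vbar <= vbar <= vbar by rewrite lexx andbT; lra.
  have := key vbar vv.
  have [d0|d0] := leP 0 d; first nra.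
  have : 0 <= vbar / 2 * s * d ^+ 2 by apply: mulr_ge0; [apply: mulr_ge0; lra | exact: sqr_ge0].
  have : 0 <= vbar / 2 / s by rewrite !divr_ge0 ?ltW.
  nra.
(* Write [lam * g = u * g + d * g + (lam' - u) * g]; [gd] bounds the middle term and [three_point]
   the last. *)
have -> : vbar / 2 * s * ((lam - u) ^+ 2 - (lam' - u) ^+ 2)
  = vbar * s * d * (lam' - u) + vbar / 2 * s * d ^+ 2 by rewrite /d; field.
move: three_point gd; rewrite /d; nra.
Qed.

(** The decision rule maximises [x * (rt - lam * ct)] over [0,1], so it beats [pol] on the
    estimates. Returning to [r] and [c] costs [delta] twice for rewards ([e1], [e3]) and
    [Lam * delta] twice for payments ([e2], [e4]); the dual step adds a third [Lam * delta]. *)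
Lemma primal_dual_step (R : realType)
    (vbar rho gam lam lam' u Lam s delta pol r c rt ct : R) (x : bool) :
  0 < vbar -> 0 < s -> 0 <= rho <= vbar -> gam <= rho ->
  0 <= lam <= Lam -> 0 <= u <= Lam -> 0 <= pol <= 1 -> 0 <= c ->
  `|rt - r| <= delta -> `|ct - c| <= delta -> ct <= vbar ->
  x = (lam * ct <= rt) ->
  lam' = Num.max (lam + 1 / (vbar * s) * (x%:R * ct - rho)) 0 ->
  pol * r <= x%:R * r + lam * (pol * c - gam) + u * (rho - x%:R * c)
    + vbar / 2 * s * ((lam - u) ^+ 2 - (lam' - u) ^+ 2)
    + vbar / 2 / s + (2 + 3 * Lam) * delta.
Proof.
move=> vbar0 s0 rhov gr lamL uL polb c0 /[dup] dr + /[dup] dc + ctv xE lamE.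
rewrite !ler_norml => /andP[r1 r2] /andP[c1 c2].
have d0 : 0 <= delta by rewrite (le_trans _ dr).
have cb : - delta <= ct <= vbar by rewrite ctv andbT; lra.
have uL' := uL; case/andP: uL' => u0 u1.
have /= := dual_step_regret vbar0 s0 rhov lamL u0 d0 cb lamE.
set q := vbar / 2 * s * _; set q' := vbar / 2 / s.
case/andP: lamL => l0 l1; case/andP: polb => p0 p1.
have best : pol * (rt - lam * ct) <= x%:R * (rt - lam * ct).
  have nn a b : 0 <= a -> 0 <= b -> 0 <= a * b := @mulr_ge0 R a b.
  rewrite xE; case: (leP (lam * ct) rt) => h /=.
    by have := nn (1 - pol) (rt - lam * ct); rewrite !subr_ge0 => /(_ p1 h) => ?; lra.
  by have := nn pol (lam * ct - rt); rewrite !subr_ge0 => /(_ p0 (ltW h)); lra.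
have p1' : 0 <= 1 - pol by lra.
have e1 : pol * (r - rt) <= delta.
  have := mulr_ge0 p1' d0.
  have h : 0 <= delta - (r - rt) by lra.
  by have := mulr_ge0 p0 h; lra.
have lp0 : 0 <= lam * pol by rewrite mulr_ge0.
have lpL : 0 <= Lam - lam * pol by have := mulr_ge0 l0 p1'; lra.
have e2 : lam * pol * (ct - c) <= Lam * delta.
  have h : 0 <= delta - (ct - c) by lra.
  by have := mulr_ge0 lp0 h; have := mulr_ge0 lpL d0; lra.
have e3 : x%:R * (rt - r) <= delta by case: (x); rewrite ?mul1r ?mul0r.
have e4 : u * (x%:R * (c - ct)) <= Lam * delta.
  have uL0 : 0 <= Lam - u by lra.
  have Ld := mulr_ge0 uL0 d0.
  have ud := mulr_ge0 u0 d0.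
  case: (x); rewrite ?mul1r ?mul0r ?mulr0; last by lra.
  have h : 0 <= delta - (c - ct) by lra.
  by have := mulr_ge0 u0 h; lra.
have e5 : 0 <= lam * (rho - gam) by rewrite mulr_ge0 // subr_ge0.
lra.
Qed.

(** * The run under full information, and the bound on its multipliers *)

Section Trajectory.
Context (R : realType) (vbar rho : R) (T : nat) (v p : nat -> R).

Definition run (k : nat) := ogd_run true vbar rho T v p k.
(* [active t] and [multiplier t] refer to the start of round t, that is, to the
   state after t - 1 rounds. *)
Definition active (t : nat) : bool := ~~ st_stop (run t.-1).
Definition multiplier (t : nat) : R := st_lam (run t.-1).
(** With full information the sample of round [t] consists of all [t.-1] earlier bids. For [t = 1]
    it is empty, and division by 0 giving 0, all estimates vanish. *)
Definition conf_width (t : nat) : R :=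
  Num.sqrt ((ln 2 + 2 * ln T%:R) / (2 * t.-1%:R)).
Definition emp (f : R -> R -> R) (t : nat) : R :=
  (\sum_(1 <= j < t) f (v t) (p j)) / t.-1%:R.
Definition reward_ucb (t : nat) : R := emp (@rwd R) t + conf_width t * v t.
Definition cost_lcb (t : nat) : R := emp (@Defs.cst R) t - 2 * conf_width t * v t.
Definition purchase (t : nat) : bool :=
  (t == 1%N) || (multiplier t * cost_lcb t <= reward_ucb t).

Lemma state_dead t : ~~ active t.+1 -> run t.+1 = run t.
Proof. by rewrite /active /run /= /ogd_step negbK => ->. Qed.

(** The description of the sample is a hypothesis here because [state_obs] is itself proved by
    induction from this lemma; [state_step] then discharges it. The case [t == 0] is round 1, which
    leaves the multiplier unchanged. *)
Lemma state_alive t (b := st_bud (run t) - (purchase t.+1)%:R * Defs.cst (v t.+1) (p t.+1)) :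
  active t.+1 -> st_obs (run t) = [seq p j | j <- iota 1 t] ->
  run t.+1 = OgdState
    (if t == 0%N then multiplier t.+1 else
      Num.max (multiplier t.+1 + 1 / (vbar * Num.sqrt t.+1%:R)
        * ((purchase t.+1)%:R * cost_lcb t.+1 - rho)) 0)
    b (rcons (st_obs (run t)) (p t.+1))
    (st_rev (run t) + (purchase t.+1)%:R * rwd (v t.+1) (p t.+1)) (b < vbar).
Proof.
rewrite /active /= => al ob; rewrite [LHS]/run /= /ogd_step -/(run t).
rewrite (negbTE al) /mean ob size_map size_iota big_map.
rewrite {}/b /purchase /reward_ucb /cost_lcb /emp /index_iota subSS subn0 /= big_map.
by rewrite eqSS; case: eqVneq => [|_] /=; rewrite -?ob.
Qed.

Lemma state_obs t : ~~ st_stop (run t) ->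
  st_obs (run t) = [seq p j | j <- iota 1 t].
Proof.
elim: t => // t IH; case: (boolP (active t.+1)) => al; last first.
  by rewrite state_dead // => h; rewrite /active h in al.
have ob := IH al.
rewrite state_alive // [st_obs _]/= ob -cats1.
by rewrite -[in RHS](addn1 t) iotaD map_cat add1n.
Qed.

Definition state_step t al := @state_alive t al (@state_obs t al).

Lemma stopped_budget k : st_stop (run k) -> st_bud (run k) < vbar.
Proof.
elim: k => // k IH; case: (boolP (active k.+1)) => al; first by rewrite state_step.
by rewrite state_dead.
Qed.

Lemma not_stopped_le j k : (j <= k)%N ->
  ~~ st_stop (run k) -> ~~ st_stop (run j).
Proof.
elim: k => [|k IH]; first by rewrite leqn0 => /eqP ->.
rewrite leq_eqVlt => /predU1P[-> //|/IH{}IH].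
by case: (boolP (active k.+1)) => [al _|al]; [exact: IH | rewrite state_dead].
Qed.

Hypothesis (vbar0 : 0 < vbar) (rho0 : 0 < rho).
Hypothesis v_bound : forall t, 0 <= v t <= vbar.
Hypothesis p_bound : forall t, 0 <= p t <= vbar.

Lemma rwd_bound (x y : R) : 0 <= x -> 0 <= y -> 0 <= rwd x y <= x.
Proof.
by move=> x0 y0; rewrite /rwd /pos_part /Num.max; case: ifP; lra.
Qed.

Lemma cst_bound (x y : R) : 0 <= x -> 0 <= y -> 0 <= Defs.cst x y <= x.
Proof. by move=> x0 y0; rewrite /Defs.cst; case: ifP; lra. Qed.

Lemma emp_le f t : (forall j, f (v t) (p j) <= v t) -> emp f t <= v t.
Proof.
move=> fv; have /andP[v0 _] := v_bound t; case: t v0 fv => [|[|t]] v0 fv.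
- by rewrite /emp big_geq // mul0r.
- by rewrite /emp big_geq // mul0r.
rewrite /emp ler_pdivrMr ?ltr0n //.
apply: (@le_trans _ _ (\sum_(1 <= j < t.+2) v t.+2)); first exact: ler_sum.
by rewrite sumr_const_nat subn1 mulr_natr.
Qed.

Lemma conf_radius_ge0 t : 0 <= conf_width t. Proof. exact: sqrtr_ge0. Qed.

Lemma cst_lcb_le t : cost_lcb t <= v t * (1 - 2 * conf_width t).
Proof.
have : emp (@Defs.cst R) t <= v t.
  apply: emp_le => j; have /andP[v0 _] := v_bound t; have /andP[p0 _] := p_bound j.
  by have /andP[] := cst_bound v0 p0.
by rewrite /cost_lcb; lra.
Qed.

Lemma cst_lcb_le_vbar t : cost_lcb t <= vbar.
Proof.
have := cst_lcb_le t; have /andP[v0 v1] := v_bound t.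
by have := mulr_ge0 (conf_radius_ge0 t) v0; lra.
Qed.

Lemma rwd_ucb_le t : reward_ucb t <= v t * (1 + conf_width t).
Proof.
have : emp (@rwd R) t <= v t.
  apply: emp_le => j; have /andP[v0 _] := v_bound t; have /andP[p0 _] := p_bound j.
  by have /andP[] := rwd_bound v0 p0.
by rewrite /reward_ucb; lra.
Qed.

(* A multiplier increase forces [cost_lcb t > rho], hence [conf_width t < 1/2]
   and, since the item was bought,
   [multiplier t <= reward_ucb t / rho <= 3/2 * vbar / rho]. *)
Definition dual_cap : R := 3 / 2 * (vbar / rho) + 1.

Lemma dual_bound t : 0 <= multiplier t <= dual_cap.
Proof.
have vbar_gt0 := vbar0; have rho_gt0 := rho0.
have vr : 0 < vbar / rho by rewrite divr_gt0.
case: t => [|t]; first by rewrite /multiplier /dual_cap /=; lra.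
elim: t => [|t]; first by rewrite /multiplier /dual_cap /=; lra.
rewrite [multiplier t.+2]/multiplier /=; case: (boolP (active t.+1)) => al; last first.
  by rewrite state_dead.
rewrite state_step //=; case: eqVneq => // t0 /andP[d0 d1].
rewrite le_max lexx orbT /= ge_max; apply/andP; split; last by rewrite /dual_cap; lra.
set s := vbar * _.
have s0 : vbar <= s.
  apply: ler_peMr; first exact: ltW.
  have : Num.sqrt 1 <= Num.sqrt t.+1%:R :> R by apply: ler_wsqrtr; rewrite ler1n.
  by rewrite sqrtr1.
have sp : 0 < s by lra.
have [cr|cr] := leP ((purchase t.+1)%:R * cost_lcb t.+1) rho.
  have : 0 <= 1 / s * (rho - (purchase t.+1)%:R * cost_lcb t.+1).
    by rewrite mulr_ge0 ?subr_ge0 // divr_ge0 ?ltW.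
  by lra.
(* The step size is at most [1 / vbar] and the cost estimate at most [vbar]: a single increase is at
   most 1, the last summand of [dual_cap]. *)
have step : 1 / s * ((purchase t.+1)%:R * cost_lcb t.+1 - rho) <= 1.
  rewrite mul1r ler_pdivrMl // mulr1; have := cst_lcb_le_vbar t.+1.
  by case: (purchase _); rewrite ?mul1r ?mul0r; lra.
suff : multiplier t.+1 <= 3 / 2 * (vbar / rho) by rewrite /dual_cap; lra.
move: cr; rewrite /purchase eqSS (negbTE t0) /=.
case: (leP (multiplier t.+1 * _)) => [affordable|_]; rewrite ?mul0r ?mul1r; last by lra.
move=> cr.
have /andP[v0 v1] := v_bound t.+1.
have := cst_lcb_le t.+1; have := rwd_ucb_le t.+1; have := conf_radius_ge0 t.+1.
set q := conf_width _ => q0 r1 c1.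
have q1 : q <= 1 / 2.
  rewrite leNgt; apply/negP => q1.
  have q2 : 0 <= 2 * q - 1 by lra.
  by have := mulr_ge0 v0 q2; lra.
have q2 : 0 <= 1 / 2 - q by lra.
have := mulr_ge0 v0 q2 => vq.
rewrite mulrA ler_pdivlMr //.
have cr0 : 0 <= cost_lcb t.+1 - rho by lra.
by have := mulr_ge0 d0 cr0; lra.
Qed.

End Trajectory.

(** Telescoping bound for the sum of the inverse square roots; it amounts to [0 <= (a - b) ^+ 2]
    with [a ^+ 2 = b ^+ 2 + 1]. *)
Lemma sqrtS_sub (R : realType) (t : nat) :
  (Num.sqrt t.+1%:R)^-1 <= 2 * (Num.sqrt t.+1%:R - Num.sqrt t%:R) :> R.
Proof.
have a0 : 0 < Num.sqrt t.+1%:R :> R by rewrite sqrtr_gt0 ltr0n.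
have b0 : 0 <= Num.sqrt t%:R :> R by exact: sqrtr_ge0.
have a2 : Num.sqrt t.+1%:R ^+ 2 = t.+1%:R :> R by rewrite sqr_sqrtr ?ler0n.
have b2 : Num.sqrt t%:R ^+ 2 = t%:R :> R by rewrite sqr_sqrtr ?ler0n.
have {a2 b2} : Num.sqrt t.+1%:R ^+ 2 = Num.sqrt t%:R ^+ 2 + 1 :> R.
  by rewrite a2 b2 natr1.
move: (Num.sqrt t.+1%:R) (Num.sqrt t%:R) a0 b0 => a b a0 b0 e.
rewrite -[X in X <= _]mul1r ler_pdivrMr //.
by have := sqr_ge0 (a - b); lra.
Qed.

(** * Regret along one sample path with small deviations *)

Section Pathwise.
Context (R : realType) (vbar rho : R) (T : nat) (v p : nat -> R).
Context (pr pc pol : R -> R) (val gam : R).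

Notation alive := (active vbar rho T v p).
Notation dual := (multiplier vbar rho T v p).
Notation state := (run vbar rho T v p).
Notation buy := (purchase vbar rho T v p).
Notation rwd_ucb := (reward_ucb T v p).
Notation cst_lcb := (cost_lcb T v p).
Notation conf_radius := (@conf_width R T).
Notation cap := (dual_cap vbar rho).
Notation L := (ln T%:R : R).

Hypotheses (vbar0 : 0 < vbar) (rho0 : 0 < rho) (rho_le : rho <= vbar).
Hypothesis v_bound : forall t, 0 <= v t <= vbar.
Hypothesis p_bound : forall t, 0 <= p t <= vbar.
Hypothesis T4 : (4 < T)%N.
Hypothesis pol_bound : forall x, 0 <= pol x <= 1.
Hypothesis pr_ge0 : forall t, 0 <= pr (v t).
Hypothesis pc_bound : forall t, 0 <= pc (v t) <= vbar.
Hypotheses (val_le : val <= vbar) (gam_le : gam <= rho).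

Hypothesis dev_rwd : forall t, (1 < t <= T)%N ->
  `|\sum_(1 <= j < t) (rwd (v t) (p j) - pr (v t))|
    <= vbar * Num.sqrt (24 * (t.-1%:R * L)).
Hypothesis dev_cst : forall t, (1 < t <= T)%N ->
  `|\sum_(1 <= j < t) (Defs.cst (v t) (p j) - pc (v t))|
    <= vbar * Num.sqrt (24 * (t.-1%:R * L)).

(** The four noise terms of a round, each signed so as to appear as a loss in [round_bound]. The
    factor [alive t] makes them vanish after stopping, so that they can be summed up to the fixed
    horizon [T]. *)
Definition round_rwd t := (alive t && buy t)%:R * (pr (v t) - rwd (v t) (p t)).
Definition round_cst t := (alive t && buy t)%:R * (Defs.cst (v t) (p t) - pc (v t)).
Definition round_val t := (alive t)%:R * (val - pol (v t) * pr (v t)).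
Definition round_pay t := (alive t)%:R * (dual t * (pol (v t) * pc (v t) - gam)).

(** The 12 covers 7 from the empirical mean ([emp_err]) and at most 4 from the confidence term
    ([radius_err], doubled for costs). *)
Definition est_err t : R := 12 * vbar * Num.sqrt L / Num.sqrt t%:R.

Lemma ln_T_ge : 1 / 2 <= L.
Proof.
have : expR (- L) <= 1 / 5.
  rewrite expRN lnK ?posrE ?ltr0n; last by case: (T) T4.
  by rewrite div1r lef_pV2 ?posrE ?ltr0n ?(ltn_trans _ T4) // (ler_nat _ 5).
by have := expR_ge1Dx (- L); lra.
Qed.

Lemma sqrt_le_sqr (x y : R) : 0 <= y -> x <= y ^+ 2 -> Num.sqrt x <= y.
Proof. by move=> y0 /ler_wsqrtr; rewrite sqrtr_sqr ger0_norm. Qed.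

(** Replaces the sample size [t - 1] by [t], using [t <= 2 * (t - 1)] for [t >= 2]; this is the
    factor 2 in the condition on [c] and [d]. *)
Lemma sqrt_dominate (c d : R) t : (1 < t)%N -> 0 <= c -> 0 <= d ->
  2 * c <= d ^+ 2 ->
  Num.sqrt (c * L / t.-1%:R) <= d * Num.sqrt L / Num.sqrt t%:R.
Proof.
case: t => [|[|t]] // _ c0 d0 cd; have L2 := ln_T_ge.
have L0 : 0 <= L by lra.
apply: sqrt_le_sqr; first by rewrite divr_ge0 ?sqrtr_ge0 // mulr_ge0 ?sqrtr_ge0.
rewrite !exprMn exprVn !sqr_sqrtr ?ler0n //=.
rewrite ler_pdivrMr ?ltr0n // [X in _ <= X]mulrAC ler_pdivlMr ?ltr0n // -[t.+2%:R]natr1.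
have t1 : 0 <= t.+1%:R - 1 :> R by rewrite -natr1 addrK ler0n.
have := mulr_ge0 c0 L0 => cL.
have := mulr_ge0 cL t1.
have : 0 <= (d ^+ 2 - 2 * c) * L * t.+1%:R by rewrite !mulr_ge0 ?ler0n // subr_ge0.
lra.
Qed.

Lemma emp_err f (m : R -> R) t : (1 < t <= T)%N ->
  `|\sum_(1 <= j < t) (f (v t) (p j) - m (v t))|
    <= vbar * Num.sqrt (24 * (t.-1%:R * L)) ->
  `|emp v p f t - m (v t)| <= 7 * vbar * Num.sqrt L / Num.sqrt t%:R.
Proof.
move=> /andP[t1 _]; rewrite sumrB sumr_const_nat subn1 => h.
have n0 : 0 < t.-1%:R :> R by rewrite ltr0n; case: (t) t1 => [|[]].
have -> : emp v p f t - m (v t) =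
    (\sum_(1 <= j < t) f (v t) (p j) - m (v t) *+ t.-1) / t.-1%:R.
  by rewrite mulrBl -(mulr_natr (m (v t))) mulfK ?gt_eqF.
rewrite normrM [`|_^-1|]gtr0_norm ?invr_gt0 // ler_pdivrMr //.
apply: (le_trans h).
have vb := vbar0; have L2 := ln_T_ge.
have L0 : 0 <= L by lra.
(* The constant 7 comes from [2 * 24 <= 7 ^+ 2]. *)
have : Num.sqrt (24 * L / t.-1%:R) <= 7 * Num.sqrt L / Num.sqrt t%:R.
  by apply: sqrt_dominate => //; lra.
have -> : Num.sqrt (24 * (t.-1%:R * L)) = Num.sqrt (24 * L / t.-1%:R) * t.-1%:R.
  rewrite -[X in _ = _ * X](ger0_norm (ltW n0)) -sqrtr_sqr -sqrtrM.
    by congr Num.sqrt; field; rewrite gt_eqF.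
  by rewrite divr_ge0 ?mulr_ge0 // ltW.
rewrite -subr_ge0 => gap; have := mulr_ge0 (mulr_ge0 (ltW vb) (ltW n0)) gap.
lra.
Qed.

Lemma radius_err t : (1 < t <= T)%N -> conf_radius t <= 2 * Num.sqrt L / Num.sqrt t%:R.
Proof.
move=> /andP[t1 tT].
have n0 : 0 < t.-1%:R :> R by rewrite ltr0n; case: (t) t1 => [|[]].
have L2 := ln_T_ge.
(* Since [ln 2 <= L], half of [ln 2 + 2 * L] is at most [2 * L]. *)
apply: le_trans (@sqrt_dominate 2 2 t t1 _ _ _); try lra.
apply: ler_wsqrtr; rewrite invfM mulrA ler_pM2r ?invr_gt0 //.
have : ln 2 <= L by rewrite ler_ln ?posrE ?ltr0n // ?ler_nat; case: (T) T4 => [|[|[]]].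
lra.
Qed.

Lemma rwd_ucb_err t : (1 < t <= T)%N -> `|rwd_ucb t - pr (v t)| <= est_err t.
Proof.
move=> ht; have := emp_err ht (dev_rwd ht); have := radius_err ht.
rewrite /reward_ucb /est_err; have := @conf_radius_ge0 R T t.
have /andP[v0 v1] := v_bound t; set e := emp _ _ _ _; rewrite -!mulrA; set q := Num.sqrt L / _.
move=> r0 rq; rewrite !ler_norml => /andP[e1 e2].
have q0 : 0 <= q by rewrite divr_ge0 ?sqrtr_ge0.
have := mulr_ge0 r0 v0; have vv : 0 <= vbar - v t by lra.
have := mulr_ge0 r0 vv; have rq' : 0 <= 2 * q - conf_radius t by lra.
have := mulr_ge0 rq' (ltW vbar0); have := mulr_ge0 q0 (ltW vbar0).
by move=> *; apply/andP; split; lra.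
Qed.

Lemma cst_lcb_err t : (1 < t <= T)%N -> `|cst_lcb t - pc (v t)| <= est_err t.
Proof.
move=> ht; have := emp_err ht (dev_cst ht); have := radius_err ht.
rewrite /cost_lcb /est_err; have := @conf_radius_ge0 R T t.
have /andP[v0 v1] := v_bound t; set e := emp _ _ _ _; rewrite -!mulrA; set q := Num.sqrt L / _.
move=> r0 rq; rewrite !ler_norml => /andP[e1 e2].
have q0 : 0 <= q by rewrite divr_ge0 ?sqrtr_ge0.
have := mulr_ge0 r0 v0; have vv : 0 <= vbar - v t by lra.
have := mulr_ge0 r0 vv; have rq' : 0 <= 2 * q - conf_radius t by lra.
have := mulr_ge0 rq' (ltW vbar0); have := mulr_ge0 q0 (ltW vbar0).
by move=> *; apply/andP; split; lra.
Qed.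

Lemma round_bound (u : R) t : 0 <= u <= cap -> (0 < t <= T)%N -> alive t ->
  val <= (buy t)%:R * rwd (v t) (p t) + u * (rho - (buy t)%:R * Defs.cst (v t) (p t))
    + round_rwd t + u * round_cst t + round_val t + round_pay t
    + vbar / 2 * Num.sqrt t%:R * ((dual t - u) ^+ 2 - (dual t.+1 - u) ^+ 2)
    + vbar / 2 / Num.sqrt t%:R + (2 + 3 * cap) * est_err t.
Proof.
move=> ub /andP[t0 tT] al.
rewrite /round_rwd /round_cst /round_val /round_pay al /=.
have db := dual_bound T vbar0 rho0 v_bound p_bound t.
have s0 : 0 < Num.sqrt t%:R :> R by rewrite sqrtr_gt0 ltr0n.
have rb : 0 <= rho <= vbar by rewrite rho_le ltW.
have /andP[c0 c1] := pc_bound t.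
(* In an active round the noise terms turn realised rewards and payments into their means, and [val]
   into [pol (v t) * pr (v t)]. *)
suff : pol (v t) * pr (v t) <= (buy t)%:R * pr (v t)
    + dual t * (pol (v t) * pc (v t) - gam) + u * (rho - (buy t)%:R * pc (v t))
    + vbar / 2 * Num.sqrt t%:R * ((dual t - u) ^+ 2 - (dual t.+1 - u) ^+ 2)
    + vbar / 2 / Num.sqrt t%:R + (2 + 3 * cap) * est_err t by lra.
have dS : dual t.+1 = if t == 1%N then dual t else
      Num.max (dual t + 1 / (vbar * Num.sqrt t%:R)
        * ((buy t)%:R * cst_lcb t - rho)) 0.
  by case: t t0 al {tT db s0 c0 c1} => // t _ al; rewrite /multiplier /= state_step.
(* Round 1 is a forced purchase with zero multiplier and without estimates. The possible loss
   [u * pc (v t)] is absorbed by [est_err 1]. *)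
case: (eqVneq t 1%N) dS => [t1 dS|t1 dS].
  have d1 : dual t = 0 by rewrite t1.
  rewrite dS d1 subrr mulr0 mul0r addr0 /purchase t1 eqxx /= /est_err sqrtr1.
  move: c0 c1 (pr_ge0 t) (pol_bound (v t)); rewrite t1.
  move: (pc _) (pr _) (pol _) => c r pi c0 c1 r0 /andP[pi0 pi1].
  have L2 := ln_T_ge.
  have L1 : 1 / 2 <= Num.sqrt L.
    rewrite -[X in X <= _]ger0_norm; last lra.
    by rewrite -sqrtr_sqr; apply: ler_wsqrtr; lra.
  have vb := vbar0; have rh := rho0.
  case/andP: ub => u0 u1.
  have pi1' : 0 <= 1 - pi by lra.
  have := mulr_ge0 pi1' r0.
  have := mulr_ge0 u0 (_ : 0 <= vbar - c); rewrite subr_ge0 => /(_ c1).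
  have := mulr_ge0 u0 (ltW rh).
  have uc : 0 <= cap - u by lra.
  have := mulr_ge0 uc (ltW vb); have := mulr_ge0 u0 (ltW vb).
  have cp : 0 <= cap by lra.
  have L1' : 0 <= Num.sqrt L - 1 / 2 by lra.
  have := mulr_ge0 (mulr_ge0 cp (ltW vb)) L1'.
  have := mulr_ge0 (ltW vb) L1'.
  lra.
have ht : (1 < t <= T)%N by rewrite tT andbT ltn_neqAle eq_sym t1.
apply: (primal_dual_step (lam := dual t) (lam' := dual t.+1)
  (rt := rwd_ucb t) (ct := cst_lcb t) (x := buy t)) => //.
- exact: rwd_ucb_err.
- exact: cst_lcb_err.
- exact: cst_lcb_le_vbar.
- by rewrite /purchase (negbTE t1).
Qed.

Notation cum f k := (\sum_(1 <= t < k.+1) f t).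

Definition live t : R := (alive t)%:R.

(** Summation by parts for the potential, whose weight grows like the square root of the round. Both
    [dual] and [u] lie in [0, [cap]], so each growth of the weight is paid at the rate [cap ^+ 2].
    The remaining per-round terms are summed by [sqrtS_sub], which doubles 12 to 24. *)
Lemma cumulative_bound (u : R) k : 0 <= u <= cap -> (k <= T)%N ->
  val * cum live k <= st_rev (state k)
    + u * (rho * cum live k - (rho * T%:R - st_bud (state k)))
    + cum round_rwd k + u * cum round_cst k + cum round_val k + cum round_pay k
    + vbar / 2 * Num.sqrt k%:R * (cap ^+ 2 - (dual k.+1 - u) ^+ 2)
    + (vbar + 24 * (2 + 3 * cap) * vbar * Num.sqrt L) * Num.sqrt k%:R.
Proof.
move=> ub; elim: k => [_|k IH kT].
  by rewrite !big_geq // sqrtr0 /run /=; lra.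
have {IH} := IH (ltnW kT).
have cumS f : cum f k.+1 = cum f k + f k.+1 :> R by rewrite (@big_nat_recr _ _ _ k.+1 1).
rewrite !cumS.
have vb := vbar0; have /andP[u0 u1] := ub.
have sS := sqrtS_sub R k.
have s0 : 0 <= Num.sqrt k%:R :> R by exact: sqrtr_ge0.
have sp : 0 < Num.sqrt k.+1%:R :> R by rewrite sqrtr_gt0 ltr0n.
have incr : 0 <= Num.sqrt k.+1%:R - Num.sqrt k%:R :> R.
  by have := invr_ge0 (Num.sqrt k.+1%:R : R); lra.
have spread j : 0 <= cap ^+ 2 - (dual j - u) ^+ 2.
  have /andP[d0 d1] := dual_bound T vbar0 rho0 v_bound p_bound j.
  have a : 0 <= cap - (dual j - u) by lra.
  have b : 0 <= cap + (dual j - u) by lra.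
  by have := mulr_ge0 a b; lra.
have sp1 := mulr_ge0 (mulr_ge0 (ltW vb) incr) (spread k.+1).
have cp : 0 <= cap by lra.
have K0 : 0 <= vbar + 24 * (2 + 3 * cap) * vbar * Num.sqrt L.
  apply: addr_ge0; first exact: ltW.
  by apply: mulr_ge0; [apply: mulr_ge0 | exact: sqrtr_ge0]; lra.
(* After stopping the state is frozen and the sums no longer change, while the square-root terms on
   the right can only grow. *)
case: (boolP (alive k.+1)) => al; last first.
  rewrite /live /round_rwd /round_cst /round_val /round_pay (negbTE al) ?andFb.
  have f0 : false%:R = 0 :> R by [].
  rewrite !f0 !mul0r !addr0.
  rewrite state_dead //.
  have -> : dual k.+2 = dual k.+1 by rewrite /multiplier /= state_dead.
  by have := mulr_ge0 K0 incr; lra.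
have := @round_bound u k.+1 ub kT al.
have -> : live k.+1 = 1 by rewrite /live al.
have -> : st_rev (state k.+1) = st_rev (state k) + (buy k.+1)%:R * rwd (v k.+1) (p k.+1).
  by rewrite state_step.
have -> : st_bud (state k.+1) = st_bud (state k) - (buy k.+1)%:R * Defs.cst (v k.+1) (p k.+1).
  by rewrite state_step.
rewrite /est_err.
have q0 := mulr_ge0 K0 (_ : 0 <= 2 * (Num.sqrt k.+1%:R - Num.sqrt k%:R) - (Num.sqrt k.+1%:R)^-1 :> R).
move: q0; rewrite subr_ge0 => /(_ sS).
lra.
Qed.

(** In units of [vbar]: the four noise sums give [10 + 10 * cap], the term [vbar * Num.sqrt k%:R]
    gives 2, the potential gives [cap ^+ 2], the estimation errors give the last summand. One more
    [cap] is kept for the budget left unspent at stopping. *)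
Definition regret_const : R :=
  vbar * (12 + 11 * cap + cap ^+ 2 + 24 * (2 + 3 * cap)).

Lemma pathwise_regret (S := vbar * Num.sqrt (24 * (T%:R * L))) :
  cum round_rwd T <= S -> cum round_cst T <= S -> cum round_val T <= S ->
  cum round_pay T <= cap * S ->
  T%:R * val - st_rev (state T) <= regret_const * Num.sqrt (T%:R * L).
Proof.
move=> A1 A2 A3 A4.
have vb := vbar0; have rh := rho0; have L2 := ln_T_ge.
have L1 : 1 / 2 <= Num.sqrt L.
  rewrite -[X in X <= _]ger0_norm; last lra.
  by rewrite -sqrtr_sqr; apply: ler_wsqrtr; lra.
have L0 : 0 <= L by lra.
have T0 : 1 <= Num.sqrt T%:R :> R.
  have : Num.sqrt 1 <= Num.sqrt T%:R :> R.
    by apply: ler_wsqrtr; rewrite ler1n (ltn_trans _ T4).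
  by rewrite sqrtr1.
have T2 : 2 <= Num.sqrt T%:R :> R.
  rewrite -[X in X <= _]ger0_norm // -sqrtr_sqr; apply: ler_wsqrtr.
  by rewrite -natrX ler_nat ltnW.
have capE : cap = 3 / 2 * (vbar / rho) + 1 by [].
have vr : 0 <= vbar / rho by rewrite divr_ge0 ?ltW.
have vrE : vbar / rho * rho = vbar by rewrite divfK ?gt_eqF.
have livesT : cum live T <= T%:R.
  apply: (@le_trans _ _ (\sum_(1 <= t < T.+1) 1)).
    by apply: ler_sum => t _; rewrite /live; case: (alive t).
  by rewrite sumr_const_nat subn1.
have S5 : S <= 5 * vbar * (Num.sqrt T%:R * Num.sqrt L).
  rewrite /S -(sqrtrM _ (ler0n _ T)) (sqrtrM _ (_ : 0 <= 24)) //.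
  have : Num.sqrt 24 <= 5 :> R by apply: sqrt_le_sqr; lra.
  have := sqrtr_ge0 (T%:R * L); set q := Num.sqrt (_ * L) => q0 h.
  have h' : 0 <= 5 - Num.sqrt 24 :> R by lra.
  by have := mulr_ge0 (mulr_ge0 (ltW vb) h') q0; lra.
rewrite (sqrtrM _ (ler0n _ T)).
(* Common part of both cases, leaving [vbar * cap] of the constant in reserve. *)
have main (u : R) : 0 <= u <= cap ->
    (val - u * rho) * cum live T + u * (rho * T%:R - st_bud (state T)) - st_rev (state T)
    <= (regret_const - vbar * cap) * (Num.sqrt T%:R * Num.sqrt L).
  move=> ub; have := @cumulative_bound u T ub (leqnn T).
  move: ub => /andP[u0 u1].
  have uA : u * cum round_cst T <= cap * S.
    have uc : 0 <= cap - u by lra.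
    have S0 : 0 <= S by rewrite mulr_ge0 // ltW.
    have := mulr_ge0 u0 (_ : 0 <= S - cum round_cst T); rewrite subr_ge0 => /(_ A2).
    by have := mulr_ge0 uc S0; lra.
  have cp : 0 <= cap by lra.
  have := mulr_ge0 cp (_ : 0 <= 5 * vbar * (Num.sqrt T%:R * Num.sqrt L) - S).
  rewrite subr_ge0 => /(_ S5).
  have s0 : 0 <= Num.sqrt T%:R :> R by lra.
  have := mulr_ge0 (mulr_ge0 (ltW vb) s0) (sqr_ge0 (dual T.+1 - u)).
  have l0 : 0 <= Num.sqrt L - 1 / 2 by lra.
  have := mulr_ge0 (mulr_ge0 (mulr_ge0 (ltW vb) s0) (sqr_ge0 cap)) l0.
  have := mulr_ge0 (mulr_ge0 (ltW vb) s0) l0.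
  rewrite /regret_const; lra.
have Q1 : 0 <= Num.sqrt T%:R * Num.sqrt L - 1.
  have a : 0 <= Num.sqrt T%:R - 2 :> R by lra.
  have b : 0 <= Num.sqrt L - 1 / 2 by lra.
  by have := mulr_ge0 a b; lra.
have capv : 0 <= vbar * cap by rewrite mulr_ge0 ?ltW //; lra.
have := mulr_ge0 capv Q1.
(* If stopped, the price [vbar / rho] values the whole budget at [vbar * T], which covers [val] in
   every unplayed round. The unspent part is below [vbar], hence worth at most [vbar * cap], which
   is the reserve. *)
case: (boolP (st_stop (state T))) => stopped.
  have bud := stopped_budget stopped.
  have ub : 0 <= vbar / rho <= cap by rewrite capE; lra.
  have := main _ ub; rewrite mulrBr mulrA vrE.
  have vv : 0 <= vbar - val by rewrite subr_ge0.
  have lt : 0 <= T%:R - cum live T by rewrite subr_ge0.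
  have := mulr_ge0 vv lt.
  have := mulr_ge0 vr (ltW (_ : 0 < vbar - st_bud (state T))).
  rewrite subr_gt0 => /(_ bud).
  have cr : 0 <= cap - vbar / rho by rewrite capE; lra.
  have := mulr_ge0 (ltW vb) cr.
  lra.
have liveT : cum live T = T%:R.
  rewrite (eq_big_nat _ _ (F2 := fun=> 1)) ?sumr_const_nat ?subn1 //.
  move=> [//|t] /andP[_ tT]; rewrite /live [alive _](_ : _ = true) //.
  by apply: not_stopped_le stopped; rewrite -ltnS ltnW.
have ub : 0 <= (0 : R) <= cap by rewrite capE; lra.
by have := main _ ub; rewrite liveT; lra.
Qed.

End Pathwise.

(** * Azuma's inequality for independent variables *)

(** For a centred variable the linear term disappears in the mean, leaving a Gaussian bound. Up to
    1/2 it follows from [expR y <= (1 - y)^-1]; beyond that, from [y <= 2 * y ^+ 2]. *)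
Lemma expR_le_linear_gauss (R : realType) (y : R) : expR y <= y + expR (2 * y ^+ 2).
Proof.
have q := expR_ge1Dx (2 * y ^+ 2).
have [y0|y0] := leP y 0.
  have d0 : 0 < 1 - y by lra.
  have : expR y <= (1 - y)^-1.
    by rewrite -[y in expR y]opprK expRN lef_pV2 ?posrE ?expR_gt0 //; exact: expR_ge1Dx.
  have : (1 - y)^-1 <= 1 + y + y ^+ 2.
    rewrite -[X in X <= _]mul1r ler_pdivrMr //.
    have y2 : 0 <= y ^+ 2 by exact: sqr_ge0.
    have y0' : 0 <= - y by lra.
    by have := mulr_ge0 y0' y2; lra.
  by have := sqr_ge0 y; lra.
have [y1|y1] := leP y (1 / 2); last first.
  have : expR y <= expR (2 * y ^+ 2).
    have a : 0 <= 2 * y - 1 by lra.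
    by rewrite ler_expR; have := mulr_ge0 (ltW y0) a; lra.
  lra.
have d0 : 0 < 1 - y by lra.
have : expR y <= (1 - y)^-1.
  by rewrite -[y in expR y]opprK expRN lef_pV2 ?posrE ?expR_gt0 //; exact: expR_ge1Dx.
have : (1 - y)^-1 <= 1 + y + 2 * y ^+ 2.
  rewrite -[X in X <= _]mul1r ler_pdivrMr //.
  have a : 0 <= 1 - 2 * y by lra.
  by have := mulr_ge0 (sqr_ge0 y) a; lra.
lra.
Qed.

Section JointLaw.
Context (R : realType) (d d1 d2 : measure_display) (Omega : measurableType d)
  (T1 : measurableType d1) (T2 : measurableType d2) (P : probability Omega R).
Context (Y : Omega -> T1) (X : Omega -> T2).
Hypotheses (mY : measurable_fun setT Y) (mX : measurable_fun setT X).
Hypothesis indep : forall A B, measurable A -> measurable B ->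
  P (Y @^-1` A `&` X @^-1` B) = (P (Y @^-1` A) * P (X @^-1` B))%E.

Let mYX : measurable_fun setT (fun w => (Y w, X w)).
Proof. exact: measurable_fun_pair. Qed.

(** Independence makes the joint law a product, and Tonelli splits the integral. In [mgf_step], [Y]
    is the identity into [Omega] with a smaller sigma-algebra, so this takes the place of
    conditioning on the past. *)
Lemma ge0_integral_indep (f : T1 * T2 -> \bar R) :
  measurable_fun [set: T1 * T2] f -> (forall z, (0 <= f z)%E) ->
  (\int[P]_w f (Y w, X w) = \int[P]_w \int[P]_w' f (Y w, X w'))%E.
Proof.
move=> mf f0.
pose lY := distribution P (mfun_Sub (mem_set mY)).
pose lX := distribution P (mfun_Sub (mem_set mX)).
pose lYX := distribution P (mfun_Sub (mem_set mYX)).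
have lE A : measurable A -> lYX A = (lY \x lX)%E A.
  move=> mA; apply/esym; exact: product_measure_unique.
transitivity (\int[lYX]_z f z)%E.
  by rewrite ge0_integral_pushforward // => z _; exact: f0.
rewrite (eq_measure_integral (lY \x lX)%E); last by move=> A mA _; exact: lE.
rewrite fubini_tonelli1 //= ge0_integral_pushforward //; last 2 first.
- exact: measurable_fun_fubini_tonelli_F.
- by move=> y _; apply: integral_ge0 => x _; exact: f0.
rewrite preimage_setT; apply: eq_integral => w _ /=.
rewrite /fubini_F ge0_integral_pushforward //.
by apply: measurableT_comp => //; exact: pair1_measurable.
Qed.

End JointLaw.

Section Concentration.
Context (R : realType) (d : measure_display) (Omega : measurableType d)
  (P : probability Omega R) (I : finType) (X : I -> Omega -> R).
Hypothesis mX : forall i, measurable_fun setT (X i).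
Hypothesis indepX : mutually_indep P X.

(** A pi-system generating the information of the [X i], i in [J]. All indices occur, with trivial
    constraints off [J], so that [mutually_indep] applies as it is stated. *)
Definition cylinder (J : pred I) : set (set Omega) :=
  [set A | exists B : I -> set R, (forall i, measurable (B i)) /\
     (forall i, ~~ J i -> B i = setT) /\
     A = \bigcap_(i in [set: I]) (X i @^-1` B i)].

(* [Omega] with the sigma-algebra generated by the [X i], i in J, so that being
   determined by these variables is ordinary measurability. *)
Definition sigmaX (J : pred I) := g_sigma_algebraType (cylinder J).

Lemma cylinder_measurable J : cylinder J `<=` measurable.
Proof.
move=> _ [B [mB [_ ->]]]; apply: fin_bigcap_measurable => // i _.
by rewrite -[X in measurable X]setTI; exact: mX.
Qed.

Lemma sigmaX_measurable J (A : set Omega) : <<s cylinder J >> A -> measurable A.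
Proof. exact: smallest_sub (@sigma_algebra_measurable _ _) (@cylinder_measurable J) A. Qed.

Lemma measurable_sigmaX J d' (U : measurableType d') (f : Omega -> U) :
  measurable_fun [set: sigmaX J] f -> measurable_fun [set: Omega] f.
Proof. by move=> mf _ B mB; apply: (@sigmaX_measurable J); exact: mf. Qed.

Lemma measurable_id_sigmaX J : measurable_fun [set: Omega] (id : Omega -> sigmaX J).
Proof. by move=> _ B mB; rewrite setTI; exact: (@sigmaX_measurable J). Qed.

Lemma measurable_X_sigmaX (J : pred I) i : J i -> measurable_fun [set: sigmaX J] (X i).
Proof.
move=> Ji _ B mB; rewrite setTI; apply: sub_sigma_algebra.
exists (fun j => if j == i then B else setT); split; first by move=> j; case: ifP.
split=> [j|]; first by case: eqP => // ->; rewrite Ji.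
apply/seteqP; split => [w Bw j _ /=|w /(_ i Logic.I) /=]; last by rewrite eqxx.
by case: eqP => // ->.
Qed.

Lemma sigmaX_mono (J J' : pred I) d' (U : measurableType d') (f : Omega -> U) :
  {subset J <= J'} -> measurable_fun [set: sigmaX J] f ->
  measurable_fun [set: sigmaX J'] f.
Proof.
move=> JJ' mf _ B mB; have := mf measurableT B mB.
apply: smallest_sub; first exact: smallest_sigma_algebra.
move=> A [C [mC [CT ->]]]; apply: sub_sigma_algebra.
exists C; split => //; split => // j J'j; apply: CT.
by apply: contra J'j; exact: JJ'.
Qed.

Lemma cylinder_setI J : setI_closed (cylinder J).
Proof.
move=> _ _ [B [mB [BT ->]]] [C [mC [CT ->]]].
exists (fun i => B i `&` C i); split; first by move=> i; exact: measurableI.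
split; first by move=> i nJ; rewrite BT // CT // setTI.
by rewrite -bigcapI.
Qed.

(** Off [J] the i-th constraint is trivial, so it can be replaced by [C]; the two product formulas
    then differ only in the factor of [i]. *)
Lemma indep_cylinder J i A C : ~~ J i -> cylinder J A -> measurable C ->
  P (A `&` X i @^-1` C) = (P A * P (X i @^-1` C))%E.
Proof.
move=> nJ [B [mB [BT ->]]] mC.
pose B' j := if j == i then C else B j.
have -> : \bigcap_(j in [set: I]) (X j @^-1` B j) `&` X i @^-1` C
    = \bigcap_(j in [set: I]) (X j @^-1` B' j).
  apply/seteqP; split => [w [Bw Cw] j _|w Bw].
    by rewrite /B' /=; case: eqP => [->//|_]; exact: Bw.
  split; last by have := Bw i Logic.I; rewrite /B' /= eqxx.
  move=> j _; have := Bw j Logic.I; rewrite /B' /=; case: eqP => // -> _.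
  by rewrite BT.
have mB' j : measurable (B' j) by rewrite /B'; case: ifP.
rewrite !indepX // (bigD1 i) //= [in RHS](bigD1 i) //=.
rewrite [B i]BT // preimage_setT probability_setT mul1e /B' eqxx muleC.
by congr (_ * _)%E; apply: eq_bigr => j /negbTE ->.
Qed.

(** As functions of [A], both sides are finite measures that agree on the pi-system of cylinders,
    hence on the sigma-algebra it generates. The right side is [P] scaled by a constant, [m2]. *)
Lemma indep_sigmaX J i A C : ~~ J i -> <<s cylinder J >> A -> measurable C ->
  P (A `&` X i @^-1` C) = (P A * P (X i @^-1` C))%E.
Proof.
move=> nJ sA mC.
have mXC : measurable (X i @^-1` C) by rewrite -[X in measurable X]setTI; exact: mX.
have fC : P (X i @^-1` C) \is a fin_num by exact: fin_num_measure.
pose m2 := mscale (NngNum (fine_ge0 (measure_ge0 P (X i @^-1` C)))) P.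
have m2E B : m2 B = (P B * P (X i @^-1` C))%E.
  by rewrite muleC -[in RHS](fineK fC).
rewrite -m2E -/(mrestr P mXC A).
apply: (@g_sigma_algebra_measure_unique _ _ _ (cylinder J) (@cylinder_measurable J)
  (fun=> setT) _ _ (mrestr P mXC) m2 (@cylinder_setI J)) => //.
- move=> _; exists (fun=> setT); split => //; split => //.
  by rewrite bigcapT // => k _; rewrite preimage_setT.
- by rewrite bigcup_const.
- by move=> B cB; apply: etrans (esym (m2E B)); exact: indep_cylinder cB mC.
- move=> _; apply: (@le_lt_trans _ _ 1%E); last exact: ltry.
  by apply: probability_le1; exact: measurableI.
Qed.


Lemma bounded_integrable (f : Omega -> R) (b : R) :
  measurable_fun setT f -> (forall w, `|f w| <= b) -> P.-integrable setT (EFin \o f).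
Proof.
move=> mf fb; apply: measurable_bounded_integrable => //.
  exact: le_lt_trans (probability_le1 P measurableT) (ltry _).
exists b; split; first exact: num_real.
by move=> x bx w _; exact: le_trans (fb w) (ltW bx).
Qed.

Lemma mgf_bounded (Z : Omega -> R) (b theta : R) :
  measurable_fun setT Z -> (forall w, `|Z w| <= b) -> 0 <= theta ->
  \int[P]_w Z w <= 0 ->
  (\int[P]_w (expR (theta * Z w))%:E <= (expR (2 * (theta * b) ^+ 2))%:E)%E.
Proof.
move=> mZ Zb theta0 Z0; set K := expR (2 * (theta * b) ^+ 2).
have iZ := bounded_integrable mZ Zb.
have le1 w : expR (theta * Z w) <= theta * Z w + K.
  apply: le_trans (expR_le_linear_gauss _) _; rewrite lerD2l ler_expR.
  rewrite ler_pM2l // !exprMn ler_wpM2l ?sqr_ge0 //.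
  by rewrite -[Z w ^+ 2]real_normK ?num_real // lerXn2r ?nnegrE // (le_trans _ (Zb w)).
have mtZ : measurable_fun setT (fun w => theta * Z w) by exact: measurable_funM.
have iK : P.-integrable setT (EFin \o (fun=> K)).
  by apply: (@bounded_integrable _ `|K|).
have itZ : P.-integrable setT (EFin \o (fun w => theta * Z w)).
  apply: (@bounded_integrable _ (theta * b)) => // w.
  by rewrite normrM ger0_norm // ler_wpM2l.
have e0 : (0 <= \int[P]_w (expR (theta * Z w))%:E)%E.
  by apply: integral_ge0 => w _; rewrite lee_fin expR_ge0.
apply: (@le_trans _ _ (\int[P]_w (theta * Z w + K)%:E)%E).
  apply: ge0_le_integral => //.
  - by apply/measurable_EFinP; exact: measurableT_comp.
  - by apply/measurable_EFinP; exact: measurable_funD.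
  - by move=> w _; rewrite lee_fin.
have -> : (\int[P]_w (theta * Z w + K)%:E)%E = (theta * (\int[P]_w Z w) + K)%:E.
  rewrite integralD_EFin //.
  rewrite EFinD; congr (_ + _)%E; last first.
    by rewrite integral_cst //= [X in (_ * X)%E](_ : _ = 1%E) ?mule1 //; exact: probability_setT.
  rewrite EFinM /Rintegral fineK; last exact: integrable_fin_num.
  by rewrite -integralZl.
by rewrite lee_fin gerDr mulr_ge0_le0.
Qed.

(** The martingale step: the past fixes [S] and the function [z w], while [X i] is fresh. By
    [ge0_integral_indep] it is integrated separately with [w] frozen, where [mgf_bounded]
    applies. *)
Lemma mgf_step (J : pred I) i (S : Omega -> R) (z : Omega -> R -> R) (b theta : R) :
  ~~ J i -> 0 <= theta ->
  measurable_fun [set: sigmaX J] S ->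
  measurable_fun [set: sigmaX J * R] (fun wx => z wx.1 wx.2) ->
  (forall w w', `|z w (X i w')| <= b) ->
  (forall w, \int[P]_w' z w (X i w') <= 0) ->
  (\int[P]_w (expR (theta * (S w + z w (X i w))))%:E <=
    (expR (2 * (theta * b) ^+ 2))%:E * \int[P]_w (expR (theta * S w))%:E)%E.
Proof.
move=> nJ theta0 mS mz zb z0.
pose f (wx : sigmaX J * R) : \bar R := (expR (theta * (S wx.1 + z wx.1 wx.2)))%:E.
have mSz : measurable_fun [set: sigmaX J * R] (fun wx => S wx.1 + z wx.1 wx.2).
  by apply: measurable_funD => //; exact: measurableT_comp.
have mf : measurable_fun [set: sigmaX J * R] f.
  apply/measurable_EFinP; apply: measurableT_comp => //; exact: measurable_funM.
have f0 wx : (0 <= f wx)%E by rewrite lee_fin expR_ge0.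
have -> := @ge0_integral_indep R _ _ _ Omega (sigmaX J) R P id (X i)
  (@measurable_id_sigmaX J) (mX i) (fun A B mA mB => indep_sigmaX nJ mA mB) f mf f0.
have mX1 : measurable_fun [set: sigmaX J * Omega] (fun ww => (ww.1, X i ww.2)).
  by apply: measurable_fun_pair => //; exact: measurableT_comp.
have mzw w : measurable_fun setT (fun w' => z w (X i w')).
  have mp : measurable_fun setT (fun w' => (w : sigmaX J, X i w')).
    exact: measurable_fun_pair.
  exact: (measurableT_comp mz mp).
rewrite -ge0_integralZl_EFin ?expR_ge0 //; last first.
  apply/measurable_EFinP; apply: measurableT_comp => //.
  by apply: measurable_funM => //; exact: measurable_sigmaX mS.
apply: ge0_le_integral => //.
- by move=> w _; apply: integral_ge0.
- apply: (@measurable_sigmaX J).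
  exact: (@measurable_fun_fubini_tonelli_F _ _ _ _ _ P _ (measurableT_comp mf mX1) (fun=> f0 _)).
- apply/measurable_EFinP; apply: measurable_funM => //; apply: measurableT_comp => //.
  by apply: measurable_funM => //; exact: measurable_sigmaX mS.
move=> w _; rewrite /f /=.
under eq_integral do rewrite mulrDr expRD EFinM.
rewrite ge0_integralZl_EFin ?expR_ge0 //; last first.
  apply/measurable_EFinP; apply: measurableT_comp => //; exact: measurable_funM.
rewrite muleC; apply: lee_wpmul2r; first by rewrite lee_fin expR_ge0.
exact: mgf_bounded.
Qed.

End Concentration.

Section Azuma.
Context (R : realType) (d : measure_display) (Omega : measurableType d)
  (P : probability Omega R) (I : finType) (X : I -> Omega -> R).
Hypothesis mX : forall i, measurable_fun setT (X i).
Hypothesis indepX : mutually_indep P X.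
Context (n : nat) (J : nat -> pred I) (i : nat -> I) (z : nat -> Omega -> R -> R)
  (b : R).
Hypothesis fresh : forall k, (k < n)%N -> ~~ J k (i k).
Hypothesis seen : forall k, (k < n)%N -> J k.+1 (i k).
Hypothesis J_mono : forall k, {subset J k <= J k.+1}.
Hypothesis mz : forall k, (k < n)%N ->
  measurable_fun [set: sigmaX X (J k) * R] (fun wx => z k wx.1 wx.2).
Hypothesis zb : forall k w w', (k < n)%N -> `|z k w (X (i k) w')| <= b.
Hypothesis z0 : forall k w, (k < n)%N -> \int[P]_w' z k w (X (i k) w') <= 0.

Let S k w := \sum_(0 <= j < k) z j w (X (i j) w).

Lemma measurable_partial_sum k : (k <= n)%N ->
  measurable_fun [set: sigmaX X (J k)] (S k).
Proof.
elim: k => [_|k IH kn]; rewrite /S.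
  by rewrite [X in measurable_fun _ X](_ : _ = fun=> 0) //; apply/funext => w; rewrite big_geq.
rewrite [X in measurable_fun _ X](_ : _ = fun w => S k w + z k w (X (i k) w)); last first.
  by apply/funext => w; rewrite big_nat_recr.
apply: measurable_funD.
  exact: (sigmaX_mono (@J_mono k) (IH (ltnW kn))).
have mid : measurable_fun [set: sigmaX X (J k.+1)]
    (id : Omega -> sigmaX X (J k)).
  exact: (sigmaX_mono (@J_mono k) (@measurable_id _ (sigmaX X (J k)) setT)).
have mp : measurable_fun [set: sigmaX X (J k.+1)]
    (fun w => (w : sigmaX X (J k), X (i k) w)).
  by apply: measurable_fun_pair => //; apply: measurable_X_sigmaX; exact: seen.
exact: (measurableT_comp (mz kn) mp).
Qed.

Lemma mgf_partial_sum theta k : 0 <= theta -> (k <= n)%N ->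
  (\int[P]_w (expR (theta * S k w))%:E <=
    (expR (2 * (theta * b) ^+ 2) ^+ k)%:E)%E.
Proof.
move=> theta0; elim: k => [_|k IH kn].
  under eq_integral do rewrite /S big_geq // mulr0 expR0.
  rewrite integral_cst // mul1e expr0; exact: probability_le1.
under eq_integral do rewrite /S big_nat_recr //=.
apply: le_trans (mgf_step mX indepX (fresh kn) theta0 (measurable_partial_sum (ltnW kn))
  (mz kn) (fun w w' => zb w w' kn) (fun w => z0 w kn)) _.
rewrite (exprS _ k) EFinM lee_wpmul2l ?lee_fin ?expR_ge0 //.
exact: IH (ltnW kn).
Qed.

Lemma azuma (L : R) : 0 < b -> (0 < n)%N -> 0 < L ->
  let A := [set w | b * Num.sqrt (24 * (n%:R * L)) <= S n w] in
  measurable A /\ (P A <= (expR (- (3 * L)))%:E)%E.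
Proof.
move=> b0 n0 L0 A; rewrite {}/A.
have mS : measurable_fun [set: Omega] (S n).
  exact: measurable_sigmaX mX _ _ _ _ (measurable_partial_sum (leqnn n)).
pose SX : {mfun Omega >-> R} := mfun_Sub (mem_set mS).
set a := b * Num.sqrt _.
have n0' : 0 < n%:R :> R by rewrite ltr0n.
have q2 : Num.sqrt (24 * (n%:R * L)) ^+ 2 = 24 * (n%:R * L).
  by rewrite sqr_sqrtr // !mulr_ge0 // ltW.
have q0 : 0 < Num.sqrt (24 * (n%:R * L)) by rewrite sqrtr_gt0 !mulr_gt0.
(* The minimiser of the Chernoff exponent [2 * n * (theta * b) ^+ 2 - theta * a]. The minimum is
   [- a ^+ 2 / (8 * n * b ^+ 2)], and 24 is chosen to make it [- 3 * L]. *)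
pose theta := Num.sqrt (24 * (n%:R * L)) / (4 * n%:R * b).
have theta0 : 0 < theta by rewrite divr_gt0 // !mulr_gt0.
have tb : theta * b = Num.sqrt (24 * (n%:R * L)) / (4 * n%:R).
  by rewrite /theta; field; rewrite !gt_eqF.
split.
  rewrite -[X in measurable X]setTI.
  exact: (measurable_fun_le measurableT (@measurable_cst _ _ _ _ setT a) mS).
apply: (le_trans (chernoff SX a theta0)).
rewrite muleC -lee_pdivlMl ?expR_gt0 // -EFinM -expRN opprK -expRD.
rewrite /mmt_gen_fun unlock /=.
under eq_integral do rewrite mulrC.
apply: (le_trans (mgf_partial_sum (ltW theta0) (leqnn n))).
rewrite lee_fin -expRM_natl ler_expR tb expr_div_n q2 /a.
have -> : theta * (b * Num.sqrt (24 * (n%:R * L)))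
    = Num.sqrt (24 * (n%:R * L)) ^+ 2 / (4 * n%:R) by rewrite /theta; field; rewrite !gt_eqF.
rewrite q2 le_eqVlt; apply/orP; left; apply/eqP.
by field; rewrite gt_eqF.
Qed.

End Azuma.

(** * Measurability of the trajectory *)

Section Measurability.
Context (R : realType) (d : measure_display) (Omega : measurableType d).

Lemma measurable_pay (f g : Omega -> R) :
  measurable_fun setT f -> measurable_fun setT g ->
  measurable_fun setT (fun w => Defs.cst (f w) (g w)).
Proof.
by move=> mf mg; apply: measurable_fun_ifT => //; exact: measurable_fun_ler.
Qed.

Lemma measurable_sum_nat (h : nat -> Omega -> R) m n :
  (forall j, (m <= j < n)%N -> measurable_fun setT (h j)) ->
  measurable_fun setT (fun w => \sum_(m <= j < n) h j w).
Proof.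
elim: n => [|n IH] mh.
  by rewrite [X in measurable_fun _ X](_ : _ = fun=> 0) //; apply/funext => w; rewrite big_geq.
have [mn|nm] := leqP m n; last first.
  by rewrite [X in measurable_fun _ X](_ : _ = fun=> 0) //; apply/funext => w; rewrite big_geq.
rewrite [X in measurable_fun _ X](_ : _ = fun w => \sum_(m <= j < n) h j w + h n w); last first.
  by apply/funext => w; rewrite big_nat_recr.
apply: measurable_funD; last by apply: mh; rewrite mn /=.
by apply: IH => j /andP[mj jn]; apply: mh; rewrite mj (leq_trans jn).
Qed.

Lemma measurable_natr_bool (f : Omega -> bool) :
  measurable_fun setT f -> measurable_fun setT (fun w => (f w)%:R : R).
Proof.
move=> mf; rewrite [X in measurable_fun _ X](_ : _ = fun w => if f w then 1 else 0).
  exact: measurable_fun_ifT.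
by apply/funext => w; case: (f w).
Qed.

Context (vbar rho : R) (T : nat) (V Pb : nat -> Omega -> R).

Lemma measurable_emp (f : R -> R -> R) t :
  measurable_fun setT (fun z : R * R => f z.1 z.2) ->
  measurable_fun setT (V t) ->
  (forall j, (0 < j < t)%N -> measurable_fun setT (Pb j)) ->
  measurable_fun setT (fun w => emp (V ^~ w) (Pb ^~ w) f t).
Proof.
move=> mf mV mP; rewrite /emp.
apply: measurable_funM => //; apply: measurable_sum_nat => j hj.
exact: (measurableT_comp mf (measurable_fun_pair mV (mP j hj))).
Qed.

Lemma measurable_rwd2 : measurable_fun setT (fun z : R * R => rwd z.1 z.2).
Proof. by apply: measurable_maxr => //; exact: measurable_funB. Qed.

Lemma measurable_cst2 : measurable_fun setT (fun z : R * R => Defs.cst z.1 z.2).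
Proof. by apply: measurable_fun_ifT => //; exact: measurable_fun_ler. Qed.

Notation alive := (fun t w => active vbar rho T (V ^~ w) (Pb ^~ w) t).
Notation dual := (fun t w => multiplier vbar rho T (V ^~ w) (Pb ^~ w) t).
Notation buy := (fun t w => purchase vbar rho T (V ^~ w) (Pb ^~ w) t).
Notation budget := (fun t w => st_bud (run vbar rho T (V ^~ w) (Pb ^~ w) t)).

Lemma measurable_lcb t : measurable_fun setT (V t) ->
  (forall j, (0 < j < t)%N -> measurable_fun setT (Pb j)) ->
  measurable_fun setT (fun w => cost_lcb T (V ^~ w) (Pb ^~ w) t).
Proof.
move=> mV mP; apply: measurable_funB; last exact: measurable_funM.
exact: measurable_emp measurable_cst2 mV mP.
Qed.

Lemma measurable_buy t :
  measurable_fun setT (V t) ->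
  (forall j, (0 < j < t)%N -> measurable_fun setT (Pb j)) ->
  measurable_fun setT (dual t) -> measurable_fun setT (buy t).
Proof.
move=> mV mP mD; rewrite /purchase.
apply: measurable_or => //; apply: measurable_fun_ler.
  by apply: measurable_funM => //; exact: measurable_lcb.
apply: measurable_funD; last exact: measurable_funM.
exact: measurable_emp measurable_rwd2 mV mP.
Qed.

(** The measurable structure on [Omega] is arbitrary, so this also yields predictability, by
    instantiation at [value_info k] and [bid_info k]; for this only the variables of rounds 1 to [k]
    are required to be measurable. *)
Lemma measurable_state k :
  (forall j, (0 < j <= k)%N -> measurable_fun setT (V j)) ->
  (forall j, (0 < j <= k)%N -> measurable_fun setT (Pb j)) ->
  [/\ measurable_fun setT (alive k.+1), measurable_fun setT (dual k.+1)
    & measurable_fun setT (budget k)].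
Proof.
elim: k => [|k IH] mV mP; first by [].
have [||mA mD mB] := IH.
- by move=> j /andP[j0 jk]; apply: mV; rewrite j0 leqW.
- by move=> j /andP[j0 jk]; apply: mP; rewrite j0 leqW.
have mVk : measurable_fun setT (V k.+1) by apply: mV; rewrite /=.
have mPk : measurable_fun setT (Pb k.+1) by apply: mP; rewrite /=.
have mPlt j : (0 < j < k.+1)%N -> measurable_fun setT (Pb j).
  by move=> /andP[j0 jk]; apply: mP; rewrite j0 ltnW.
have mBuy := measurable_buy mVk mPlt mD.
have mB1 : measurable_fun setT (budget k.+1).
  rewrite [X in measurable_fun _ X](_ : _ = fun w => if alive k.+1 w then
    budget k w - (buy k.+1 w)%:R * Defs.cst (V k.+1 w) (Pb k.+1 w) else budget k w).
    apply: measurable_fun_ifT => //; apply: measurable_funB => //.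
    apply: measurable_funM; first exact: measurable_natr_bool.
    exact: measurable_pay.
  by apply/funext => w; case: ifPn => al; [rewrite state_step | rewrite state_dead].
split=> //.
  rewrite [X in measurable_fun _ X](_ : _ = fun w => alive k.+1 w && (vbar <= budget k.+1 w)).
    by apply: measurable_and => //; exact: measurable_fun_ler.
  apply/funext => w; rewrite {1}/active [k.+2.-1]/=.
  case: (boolP (alive k.+1 w)) => al /=; last by rewrite state_dead //; exact: negbTE.
  by rewrite state_step //= leNgt.
rewrite [X in measurable_fun _ X](_ : _ = fun w => if alive k.+1 w then
    (if k == 0%N then dual k.+1 w else
      Num.max (dual k.+1 w + 1 / (vbar * Num.sqrt k.+1%:R)
        * ((buy k.+1 w)%:R * cost_lcb T (V ^~ w) (Pb ^~ w) k.+1 - rho)) 0)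
    else dual k.+1 w).
  apply: measurable_fun_ifT => //; case: (k == 0%N) => //.
  apply: measurable_maxr => //; apply: measurable_funD => //.
  apply: measurable_funM => //; apply: measurable_funB => //.
  apply: measurable_funM; first exact: measurable_natr_bool.
  exact: measurable_lcb.
apply/funext => w; rewrite {1}/multiplier [k.+2.-1]/=.
by case: ifPn => al; [rewrite state_step | rewrite state_dead].
Qed.

End Measurability.

(** * Deviation events and the regret bound *)

Lemma law_integral (R : realType) d (Omega : measurableType d)
    (P : probability Omega R) (Y : Omega -> R) (mu : probability R R) (f : R -> R) :
  measurable_fun setT Y -> measurable_fun setT f ->
  P.-integrable setT (EFin \o (f \o Y)) -> has_law P Y mu ->
  (\int[P]_w (f (Y w))%:E = \int[mu]_x (f x)%:E)%E.
Proof.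
move=> mY mf iY lY.
transitivity (\int[distribution P (mfun_Sub (mem_set mY))]_x (f x)%:E)%E.
  by rewrite integral_pushforward //; exact/measurable_EFinP.
by apply: eq_measure_integral => A mA _; exact: lY.
Qed.

Section Model.
Context (R : realType) (vbar rho : R) (T : nat) (d : measure_display)
  (Omega : measurableType d) (P : probability Omega R) (V Pb : nat -> Omega -> R)
  (F G : probability R R).
Hypotheses (vbar0 : 0 < vbar) (rho0 : 0 < rho) (rho_le : rho <= vbar).
Hypothesis T0 : (0 < T)%N.
Hypothesis mV : forall t, measurable_fun setT (V t).
Hypothesis mP : forall t, measurable_fun setT (Pb t).
Hypothesis V_bound : forall t w, 0 <= V t w <= vbar.
Hypothesis P_bound : forall t w, 0 <= Pb t w <= vbar.
Hypothesis V_law : forall t, (1 <= t <= T)%N -> has_law P (V t) F.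
Hypothesis P_law : forall t, (1 <= t <= T)%N -> has_law P (Pb t) G.

Let X (ib : 'I_T * bool) : Omega -> R :=
  if ib.2 then Pb (ib.1).+1 else V (ib.1).+1.

Hypothesis indep : mutually_indep P X.

Let mX ib : measurable_fun setT (X ib).
Proof. by rewrite /X; case: ifP. Qed.

(** A total indexing by natural numbers; indices from [T] on are sent to 0. *)
Let ix (k : nat) : 'I_T := insubd (Ordinal T0) k.

Let ixE k : (k < T)%N -> ix k = k :> nat.
Proof. by move=> kT; rewrite /ix val_insubd kT. Qed.

(* The variables revealed before the k-th step of the two filtrations; rounds
   are 1-based, so ([i], b) stands for round i + 1, with b = true for its bid. *)
Definition values_first (k : nat) : pred ('I_T * bool) :=
  fun ib => ~~ ib.2 || (ib.1 < k)%N.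
Definition bids_first (k : nat) : pred ('I_T * bool) :=
  fun ib => ib.2 || (ib.1 < k)%N.

Definition value_info k := sigmaX X (values_first k).
Definition bid_info k := sigmaX X (bids_first k).

Lemma measurable_V_value_info k t : (0 < t <= T)%N ->
  measurable_fun [set: value_info k] (V t).
Proof.
case: t => // t /andP[_ tT].
have := @measurable_X_sigmaX _ _ _ _ X (values_first k) (ix t, false) isT.
by rewrite /X /= ixE.
Qed.

Lemma measurable_P_value_info k t : (0 < t <= k)%N -> (t <= T)%N ->
  measurable_fun [set: value_info k] (Pb t).
Proof.
case: t => // t /andP[_ tk] tT.
have := @measurable_X_sigmaX _ _ _ _ X (values_first k) (ix t, true).
by rewrite /X {1}/values_first /= ixE //; apply.
Qed.

Lemma measurable_P_bid_info k t : (0 < t <= T)%N ->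
  measurable_fun [set: bid_info k] (Pb t).
Proof.
case: t => // t /andP[_ tT].
have := @measurable_X_sigmaX _ _ _ _ X (bids_first k) (ix t, true) isT.
by rewrite /X /= ixE.
Qed.

Lemma measurable_V_bid_info k t : (0 < t <= k)%N -> (t <= T)%N ->
  measurable_fun [set: bid_info k] (V t).
Proof.
case: t => // t /andP[_ tk] tT.
have := @measurable_X_sigmaX _ _ _ _ X (bids_first k) (ix t, false).
by rewrite /X {1}/bids_first /= ixE //; apply.
Qed.

(** What rewards and payments share. The second clause allows any real value [x], so that [avg f x]
    is a genuine integral on the whole line; the third is the sharp bound on the actual range. *)
Definition outcome_fun (f : R -> R -> R) := [/\
  measurable_fun setT (fun z : R * R => f z.1 z.2),
  forall x y, 0 <= y <= vbar -> 0 <= f x y <= `|x| + vbar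
  & forall x y, 0 <= x <= vbar -> 0 <= y <= vbar -> f x y <= vbar].

Lemma outcome_rwd : outcome_fun (@rwd R).
Proof.
split; first exact: measurable_rwd2.
  move=> x y /andP[y0 y1]; have := ler_norm x; have := normr_ge0 x.
  by rewrite /rwd /pos_part /Num.max; case: ifP; have := vbar0; lra.
by move=> x y; rewrite /rwd /pos_part /Num.max; case: ifP; have := vbar0; lra.
Qed.

Lemma outcome_cst : outcome_fun (@Defs.cst R).
Proof.
split; first exact: measurable_cst2.
  move=> x y /andP[y0 y1]; have := normr_ge0 x.
  by rewrite /Defs.cst; case: ifP; have := vbar0; lra.
by move=> x y; rewrite /Defs.cst; case: ifP; have := vbar0; lra.
Qed.

(** Taken over [Omega], where bids are bounded everywhere. Round 1 stands for all rounds
    ([avg_law]), and [avgE] links it to [G]. *)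
Definition avg (f : R -> R -> R) (x : R) : R := \int[P]_w f x (Pb 1 w).

Section OutcomeFun.
Context (f : R -> R -> R) (fP : outcome_fun f).

Lemma measurable_outcome x : measurable_fun setT (f x).
Proof.
case: fP => mf _ _.
have mp : measurable_fun setT (fun y : R => (x, y)) by exact: measurable_fun_pair.
exact: (measurableT_comp mf mp).
Qed.

Lemma integrable_outcome x t : P.-integrable setT (EFin \o (f x \o Pb t)).
Proof.
apply: (@bounded_integrable _ _ _ _ _ (`|x| + vbar)).
  by apply: measurableT_comp => //; exact: measurable_outcome.
move=> w; case: fP => _ /(_ x _ (P_bound t w)) /andP[f0 f1] _.
by rewrite ger0_norm.
Qed.

Lemma avg_law t x : (1 <= t <= T)%N -> \int[P]_w f x (Pb t w) = avg f x.
Proof.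
move=> tT; rewrite /avg /Rintegral; congr fine.
rewrite (law_integral (mP t) (measurable_outcome x) (integrable_outcome x t) (P_law tT)).
rewrite (law_integral (mP 1) (measurable_outcome x) (integrable_outcome x 1) (P_law _)) //.
Qed.

Lemma avgE x : (\int[G]_y (f x y)%:E = (avg f x)%:E)%E.
Proof.
have h1 : (1 <= 1 <= T)%N by rewrite T0.
rewrite -(law_integral (mP 1) (measurable_outcome x) (integrable_outcome x 1) (P_law h1)).
by rewrite /avg /Rintegral fineK //; apply: integrable_fin_num => //; exact: integrable_outcome.
Qed.

Lemma avg_ge0 x : 0 <= avg f x.
Proof.
apply: Rintegral_ge0 => w _; case: fP => _ /(_ x _ (P_bound 1 w)) /andP[] //.
Qed.

Lemma avg_le x : 0 <= x <= vbar -> avg f x <= vbar.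
Proof.
move=> xb; have -> : vbar = \int[P]_w vbar.
  by rewrite Rintegral_cst // [X in _ * fine X]probability_setT mulr1.
apply: le_Rintegral => //.
- exact: integrable_outcome.
- by apply: (@bounded_integrable _ _ _ _ _ `|vbar|).
by move=> w _; case: fP => _ _; apply.
Qed.

Lemma measurable_avg : measurable_fun setT (avg f).
Proof.
case: fP => mf f0 _.
have mg : measurable_fun [set: R * Omega] (fun z => (f z.1 (Pb 1 z.2))%:E).
  apply/measurable_EFinP.
  have mp : measurable_fun [set: R * Omega] (fun z => (z.1, Pb 1 z.2)).
    by apply: measurable_fun_pair => //; exact: measurableT_comp.
  exact: (measurableT_comp mf mp).
have g0 (z : R * Omega) : (0 <= (f z.1 (Pb 1 z.2))%:E)%E.
  by have /andP[] := f0 z.1 _ (P_bound 1 z.2); rewrite lee_fin.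
apply/measurable_EFinP.
rewrite (_ : EFin \o avg f = fubini_F P (fun z : R * Omega => (f z.1 (Pb 1 z.2))%:E)).
  exact: measurable_fun_fubini_tonelli_F.
apply/funext => x; rewrite /fubini_F /= /avg /Rintegral fineK //.
exact: (integrable_fin_num measurableT (integrable_outcome x 1)).
Qed.

(** With all values revealed first, [V (s k)] is known for any round [s k], even a future one. A
    constant [s] gives the estimation errors, where one value meets all earlier bids; the successor
    gives the realised outcomes. *)
Lemma bid_deviation (n : nat) (c : nat -> Omega -> R) (s : nat -> nat) (L : R) :
  (0 < n <= T)%N -> 0 < L ->
  (forall k, (k < n)%N -> (0 < s k <= T)%N) ->
  (forall k, (k < n)%N -> measurable_fun [set: value_info k] (c k)) ->
  (forall k w, `|c k w| <= 1) ->
  let A := [set w | vbar * Num.sqrt (24 * (n%:R * L)) <=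
    \sum_(1 <= t < n.+1) c t.-1 w * (f (V (s t.-1) w) (Pb t w) - avg f (V (s t.-1) w))] in
  measurable A /\ (P A <= (expR (- (3 * L)))%:E)%E.
Proof.
move=> /andP[n0 nT] L0 sT mc c1 A.
have [mf f0 f1] := fP.
pose z k w y := c k w * (f (V (s k) w) y - avg f (V (s k) w)).
have XE k w : (k < n)%N -> X (ix k, true) w = Pb k.+1 w.
  by move=> kn; rewrite /X /= ixE // (leq_trans kn).
have sumE w : \sum_(1 <= t < n.+1)
      c t.-1 w * (f (V (s t.-1) w) (Pb t w) - avg f (V (s t.-1) w))
    = \sum_(0 <= k < n) z k w (X (ix k, true) w).
  by rewrite big_add1; apply: eq_big_nat => k /andP[_ kn]; rewrite /z XE.
rewrite {}/A (_ : [set w | _] = [set w | vbar * Num.sqrt (24 * (n%:R * L)) <=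
    \sum_(0 <= k < n) z k w (X (ix k, true) w)]); last first.
  by apply: eq_set => w; rewrite sumE.
have dev k w w' : `|f (V (s k) w) (X (ix k, true) w') - avg f (V (s k) w)| <= vbar.
  have xb := V_bound (s k) w.
  have yb : 0 <= X (ix k, true) w' <= vbar by exact: P_bound.
  have /andP[h0 _] := f0 (V (s k) w) _ yb.
  have h1 := f1 _ _ xb yb; have h2 := avg_ge0 (V (s k) w); have h3 := avg_le xb.
  by rewrite ler_norml; apply/andP; split; lra.
apply: (azuma (J := values_first) (i := fun k => (ix k, true)) (z := z) mX indep) => //.
- by move=> k kn; rewrite /values_first /= ixE ?ltnn // (leq_trans kn).
- by move=> k kn; rewrite /values_first /= ixE ?ltnSn // (leq_trans kn).
- move=> k ib; rewrite /values_first !unfold_in /= => /orP[->//|h].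
  by rewrite (ltn_trans h) ?ltnSn // orbT.
- move=> k kn; have mVk := measurable_V_value_info (k := k) (sT k kn).
  have m1 : measurable_fun [set: value_info k * R] (fun wx => V (s k) wx.1).
    exact: (measurableT_comp mVk measurable_fst).
  apply: measurable_funM; first exact: (measurableT_comp (mc k kn) measurable_fst).
  apply: measurable_funB; last exact: (measurableT_comp measurable_avg m1).
  exact: (measurableT_comp mf (measurable_fun_pair m1 measurable_snd)).
- move=> k w w' kn; rewrite /z normrM -[X in _ <= X]mul1r.
  by apply: ler_pM => //; exact: dev.
move=> k w kn; rewrite /z.
have -> : (fun w' => c k w * (f (V (s k) w) (X (ix k, true) w') - avg f (V (s k) w)))
   = (fun w' => c k w * (f (V (s k) w) (Pb k.+1 w') - avg f (V (s k) w))).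
  by apply/funext => w'; rewrite XE.
have i1 : P.-integrable setT (EFin \o (fun w' => f (V (s k) w) (Pb k.+1 w'))).
  exact: integrable_outcome.
have i2 : P.-integrable setT (EFin \o (fun=> avg f (V (s k) w))).
  by apply: (@bounded_integrable _ _ _ _ _ `|avg f (V (s k) w)|).
rewrite RintegralZl //; last exact: (integrableB measurableT i1 i2).
rewrite RintegralB // Rintegral_cst // [X in _ * fine X]probability_setT mulr1.
by rewrite avg_law ?subrr ?mulr0 // (leq_trans kn).
Qed.

End OutcomeFun.

(** Here the fresh variable is the value of round k + 1, and [c k] may depend on every bid and on
    the earlier values. *)
Lemma value_deviation (n : nat) (c : nat -> Omega -> R) (g : R -> R) (b K L : R) :
  (0 < n <= T)%N -> 0 < L -> 0 < b -> 0 < K ->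
  (forall k, (k < n)%N -> measurable_fun [set: bid_info k] (c k)) ->
  (forall k w, `|c k w| <= K) ->
  measurable_fun setT g -> (forall x, 0 <= x <= vbar -> `|g x| <= b) ->
  \int[P]_w g (V 1 w) = 0 ->
  let A := [set w | K * b * Num.sqrt (24 * (n%:R * L)) <=
    \sum_(1 <= t < n.+1) c t.-1 w * g (V t w)] in
  measurable A /\ (P A <= (expR (- (3 * L)))%:E)%E.
Proof.
move=> /andP[n0 nT] L0 b0 K0 mc cK mg gb g0 A.
have XE k w : (k < n)%N -> X (ix k, false) w = V k.+1 w.
  by move=> kn; rewrite /X /= ixE // (leq_trans kn).
pose z k w x := c k w * g x.
have sumE w : \sum_(1 <= t < n.+1) c t.-1 w * g (V t w)
    = \sum_(0 <= k < n) z k w (X (ix k, false) w).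
  by rewrite big_add1; apply: eq_big_nat => k /andP[_ kn]; rewrite /z XE.
rewrite {}/A (_ : [set w | _] = [set w | K * b * Num.sqrt (24 * (n%:R * L)) <=
    \sum_(0 <= k < n) z k w (X (ix k, false) w)]); last first.
  by apply: eq_set => w; rewrite sumE.
have iV t : P.-integrable setT (EFin \o (g \o V t)).
  apply: (@bounded_integrable _ _ _ _ _ b); first exact: measurableT_comp.
  by move=> w; exact: gb.
apply: (azuma (J := bids_first) (i := fun k => (ix k, false)) (z := z) mX indep) => //.
- by move=> k kn; rewrite /bids_first /= ixE ?ltnn // (leq_trans kn).
- by move=> k kn; rewrite /bids_first /= ixE ?ltnSn // (leq_trans kn).
- move=> k ib; rewrite /bids_first !unfold_in /= => /orP[->//|h].
  by rewrite (ltn_trans h) ?ltnSn // orbT.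
- move=> k kn; apply: measurable_funM.
    exact: (measurableT_comp (mc k kn) measurable_fst).
  exact: (measurableT_comp mg measurable_snd).
- move=> k w w' kn; rewrite /z normrM.
  by apply: ler_pM => //; apply: gb; exact: V_bound.
- move=> k w kn; rewrite /z.
  have -> : (fun w' => c k w * g (X (ix k, false) w')) = (fun w' => c k w * g (V k.+1 w')).
    by apply/funext => w'; rewrite XE.
  have kT : (1 <= k.+1 <= T)%N by rewrite (leq_trans kn).
  have oT : (1 <= 1 <= T)%N by rewrite T0.
  rewrite RintegralZl //; last exact: (iV k.+1).
  rewrite (_ : \int[P]_w' g (V k.+1 w') = 0) ?mulr0 // -g0 /Rintegral; congr fine.
  rewrite (law_integral (mV k.+1) mg (iV k.+1) (V_law kT)).
  by rewrite (law_integral (mV 1) mg (iV 1%N) (V_law oT)).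
by rewrite mulr_gt0.
Qed.

Lemma unlikelyU (A B : set Omega) (a b : R) :
  measurable A /\ (P A <= a%:E)%E -> measurable B /\ (P B <= b%:E)%E ->
  measurable (A `|` B) /\ (P (A `|` B) <= (a + b)%:E)%E.
Proof.
move=> [mA PA] [mB PB]; split; first exact: measurableU.
by apply: le_trans (measureU2 P mA mB) _; rewrite EFinD; exact: leeD.
Qed.

Lemma unlikely_bigU (A : nat -> set Omega) (a : R) n :
  (forall i, (i < n)%N -> measurable (A i) /\ (P (A i) <= a%:E)%E) ->
  let B := \bigcup_(i < n) A i in measurable B /\ (P B <= (n%:R * a)%:E)%E.
Proof.
rewrite bigcup_mkord; elim: n => [|n IH] hA /=.
  by rewrite big_ord0 mul0r measure0.
rewrite big_ord_recr /= -natr1 mulrDl mul1r.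
by apply: unlikelyU; [apply: IH => i ni; apply: hA; rewrite ltnW | exact: hA].
Qed.

(** * The good event for a fixed policy *)

Section GoodEvent.
Context (pol : R -> R).
Hypothesis (mpol : measurable_fun setT pol) (pol_bound : forall x, 0 <= pol x <= 1).
Hypothesis T4 : (4 < T)%N.

Notation L := (ln T%:R : R).
Notation r := (avg (@rwd R)).
Notation c := (avg (@Defs.cst R)).

Definition pol_value (f : R -> R -> R) : R := \int[P]_w (pol (V 1 w) * avg f (V 1 w)).

Section PolicyValue.
Context (f : R -> R -> R) (fP : outcome_fun f).

Lemma measurable_pol_avg : measurable_fun setT (fun x => pol x * avg f x).
Proof. by apply: measurable_funM => //; exact: measurable_avg. Qed.

Lemma pol_avg_bound x : 0 <= x <= vbar -> 0 <= pol x * avg f x <= vbar.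
Proof.
move=> xb; have /andP[p0 p1] := pol_bound x.
have a0 := avg_ge0 fP x; have a1 := avg_le fP xb.
have p1' : 0 <= 1 - pol x by lra.
by have := mulr_ge0 p0 a0; have := mulr_ge0 p1' a0; lra.
Qed.

Lemma integrable_pol_avg t : P.-integrable setT (EFin \o (fun w => pol (V t w) * avg f (V t w))).
Proof.
apply: (@bounded_integrable _ _ _ _ _ vbar).
  exact: (measurableT_comp measurable_pol_avg (mV t)).
by move=> w; have /andP[h0 h1] := pol_avg_bound (V_bound t w); rewrite ger0_norm.
Qed.

Lemma pol_value_bound : 0 <= pol_value f <= vbar.
Proof.
apply/andP; split.
  by apply: Rintegral_ge0 => w _; have /andP[] := pol_avg_bound (V_bound 1 w).
have -> : vbar = \int[P]_w vbar.
  by rewrite Rintegral_cst // [X in _ * fine X]probability_setT mulr1.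
apply: le_Rintegral => //.
- exact: integrable_pol_avg.
- by apply: (@bounded_integrable _ _ _ _ _ `|vbar|).
by move=> w _; have /andP[] := pol_avg_bound (V_bound 1 w).
Qed.

Lemma pol_value_dev : \int[P]_w (pol (V 1 w) * avg f (V 1 w) - pol_value f) = 0.
Proof.
rewrite RintegralB //; last 2 first.
- exact: integrable_pol_avg.
- by apply: (@bounded_integrable _ _ _ _ _ `|pol_value f|).
by rewrite Rintegral_cst // [X in _ * fine X]probability_setT mulr1 subrr.
Qed.

End PolicyValue.

Notation val := (pol_value (@rwd R)).
Notation gam := (pol_value (@Defs.cst R)).
Hypothesis gam_le : gam <= rho.

Notation alive := (fun t w => active vbar rho T (V ^~ w) (Pb ^~ w) t).
Notation dual := (fun t w => multiplier vbar rho T (V ^~ w) (Pb ^~ w) t).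
Notation buy := (fun t w => purchase vbar rho T (V ^~ w) (Pb ^~ w) t).
Notation cap := (dual_cap vbar rho).

Let q : R := expR (- (3 * L)).

Definition exceeds n (Y : Omega -> R) (K : R) : set Omega :=
  [set w | K * Num.sqrt (24 * (n%:R * L)) <= Y w].

(** The sign [e] selects a tail. Both are used for the estimates, where an absolute value is
    bounded; each deviation of the whole run is bounded on one side only. *)
Definition est_dev f (e : R) k : set Omega := exceeds k.+1
  (fun w => \sum_(1 <= j < k.+2) e * (f (V k.+2 w) (Pb j w) - avg f (V k.+2 w))) vbar.

Definition play_dev f (e : R) : set Omega := exceeds T
  (fun w => \sum_(1 <= t < T.+1) e * (alive t w && buy t w)%:R
     * (f (V t w) (Pb t w) - avg f (V t w))) vbar.

Definition val_dev : set Omega := exceeds T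
  (fun w => \sum_(1 <= t < T.+1) (alive t w)%:R * - (pol (V t w) * r (V t w) - val)) vbar.

Definition pay_dev : set Omega := exceeds T
  (fun w => \sum_(1 <= t < T.+1) (alive t w)%:R * dual t w
     * (pol (V t w) * c (V t w) - gam)) (cap * vbar).

(* Index 0 collects the deviations of the whole run, index k + 1 the estimation
   errors of round k + 2; round 1 makes no estimate. *)
Definition bad (i : nat) : set Omega :=
  if i is k.+1 then
    est_dev (@rwd R) 1 k `|` est_dev (@rwd R) (-1) k
    `|` est_dev (@Defs.cst R) 1 k `|` est_dev (@Defs.cst R) (-1) k
  else play_dev (@rwd R) (-1) `|` play_dev (@Defs.cst R) 1 `|` val_dev `|` pay_dev.

Let L0 : 0 < L.
Proof. by apply: ln_gt0; rewrite ltr1n (ltn_trans _ T4). Qed.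

Let unlikely (A : set Omega) := measurable A /\ (P A <= q%:E)%E.

Lemma est_dev_unlikely f e k : outcome_fun f -> `|e| <= 1 -> (k.+1 < T)%N ->
  unlikely (est_dev f e k).
Proof.
move=> fP e1 kT; apply: (@bid_deviation f fP k.+1 (fun _ _ => e) (fun=> k.+2) L) => //.
exact: ltnW.
Qed.

(** The purchase of round k + 1 looks at the value of that round but not at its bid. It is thus
    predictable when values come first; in the other order, treated next, only activity and
    multiplier are claimed. *)
Lemma measurable_state_value_info k : (k < T)%N ->
  [/\ measurable_fun [set: value_info k] (alive k.+1)
    & measurable_fun [set: value_info k] (buy k.+1)].
Proof.
move=> kT.
have mVk j : (0 < j <= k.+1)%N -> measurable_fun [set: value_info k] (V j).
  by move=> /andP[j0 jk]; apply: measurable_V_value_info; rewrite j0 (leq_trans jk).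
have mPk j : (0 < j <= k)%N -> measurable_fun [set: value_info k] (Pb j).
  move=> /andP[j0 jk]; apply: measurable_P_value_info; first by rewrite j0.
  by rewrite (leq_trans jk) // ltnW.
have mVk' j : (0 < j <= k)%N -> measurable_fun [set: value_info k] (V j).
  by move=> /andP[j0 jk]; apply: mVk; rewrite j0 leqW.
have [mA mD _] := measurable_state vbar rho T mVk' mPk.
by split=> //; apply: measurable_buy => //; apply: mVk; rewrite /=.
Qed.

Lemma measurable_state_bid_info k : (k < T)%N ->
  [/\ measurable_fun [set: bid_info k] (alive k.+1)
    & measurable_fun [set: bid_info k] (dual k.+1)].
Proof.
move=> kT.
have mVk j : (0 < j <= k)%N -> measurable_fun [set: bid_info k] (V j).
  move=> /andP[j0 jk]; apply: measurable_V_bid_info; first by rewrite j0.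
  by rewrite (leq_trans jk) // ltnW.
have mPk j : (0 < j <= k)%N -> measurable_fun [set: bid_info k] (Pb j).
  by move=> /andP[j0 jk]; apply: measurable_P_bid_info; rewrite j0 (leq_trans jk) // ltnW.
by have [mA mD _] := measurable_state vbar rho T mVk mPk; split.
Qed.

Lemma play_dev_unlikely f e : outcome_fun f -> `|e| <= 1 -> unlikely (play_dev f e).
Proof.
move=> fP e1.
pose co k w : R := e * (alive k.+1 w && buy k.+1 w)%:R.
have -> : play_dev f e = exceeds T (fun w =>
    \sum_(1 <= t < T.+1) co t.-1 w * (f (V t.-1.+1 w) (Pb t w) - avg f (V t.-1.+1 w))) vbar.
  by apply: eq_set => w; congr (_ <= _); apply: eq_big_nat => -[].
apply: (bid_deviation (s := succn) fP) => //; first by rewrite T0 leqnn.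
  move=> k kT; have [mA mB] := measurable_state_value_info kT.
  apply: measurable_funM => //; apply: measurable_natr_bool; exact: measurable_and.
by move=> k w; rewrite /co; case: (_ && _); rewrite ?mulr1 // mulr0 normr0.
Qed.

Lemma val_dev_unlikely : unlikely val_dev.
Proof.
pose co k w : R := (alive k.+1 w)%:R.
have -> : val_dev = exceeds T (fun w =>
    \sum_(1 <= t < T.+1) co t.-1 w * - (pol (V t w) * r (V t w) - val)) (1 * vbar).
  by apply: eq_set => w; rewrite mul1r; congr (_ <= _); apply: eq_big_nat => -[].
apply: (value_deviation (g := fun x => - (pol x * r x - val))) => //.
- by rewrite T0 leqnn.
- move=> k kT; have [mA _] := measurable_state_bid_info kT.
  exact: measurable_natr_bool.
- by move=> k w; rewrite /co; case: (alive _ _); rewrite ?normr1 ?normr0.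
- apply: measurableT_comp => //; apply: measurable_funB => //.
  exact: measurable_pol_avg outcome_rwd.
- move=> x xb; have := pol_avg_bound outcome_rwd xb; have := pol_value_bound outcome_rwd.
  by move=> /andP[a1 a2] /andP[b1 b2]; rewrite ler_norml; apply/andP; split; lra.
under eq_Rintegral do rewrite -mulN1r.
rewrite RintegralZl // ?pol_value_dev ?mulr0 //; first exact: outcome_rwd.
apply: (@bounded_integrable _ _ _ _ _ vbar).
  apply: measurable_funB => //.
  exact: (measurableT_comp (measurable_pol_avg outcome_rwd) (mV 1)).
move=> w; have := pol_avg_bound outcome_rwd (V_bound 1 w).
have := pol_value_bound outcome_rwd.
by move=> /andP[a1 a2] /andP[b1 b2]; rewrite ler_norml; apply/andP; split; lra.
Qed.

Lemma pay_dev_unlikely : unlikely pay_dev.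
Proof.
pose co k w : R := (alive k.+1 w)%:R * dual k.+1 w.
have -> : pay_dev = exceeds T (fun w =>
    \sum_(1 <= t < T.+1) co t.-1 w * (pol (V t w) * c (V t w) - gam)) (cap * vbar).
  by apply: eq_set => w; congr (_ <= _); apply: eq_big_nat => -[].
have cap0 : 0 < cap by rewrite /dual_cap ltr_wpDl // mulr_ge0 // divr_ge0 // ltW.
apply: (value_deviation (g := fun x => pol x * c x - gam)) => //.
- by rewrite T0 leqnn.
- move=> k kT; have [mA mD] := measurable_state_bid_info kT.
  by apply: measurable_funM => //; exact: measurable_natr_bool.
- move=> k w; rewrite /co.
  have /andP[d0 d1] := dual_bound T vbar0 rho0 (V_bound ^~ w) (P_bound ^~ w) k.+1.
  by case: (alive _ _); rewrite ?mul1r ?mul0r ?normr0 ?ger0_norm // ltW.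
- apply: measurable_funB => //; exact: measurable_pol_avg outcome_cst.
- move=> x xb; have := pol_avg_bound outcome_cst xb; have := pol_value_bound outcome_cst.
  by move=> /andP[a1 a2] /andP[b1 b2]; rewrite ler_norml; apply/andP; split; lra.
exact: pol_value_dev outcome_cst.
Qed.

Lemma bad_unlikely i : (i < T)%N ->
  measurable (bad i) /\ (P (bad i) <= (q + q + q + q)%:E)%E.
Proof.
have n1 : `|-1| <= 1 :> R by rewrite normrN1.
have p1 : `|1| <= 1 :> R by rewrite normr1.
case: i => [_|k kT]; rewrite /bad; do 3?[apply: unlikelyU].
- exact: play_dev_unlikely outcome_rwd _.
- exact: play_dev_unlikely outcome_cst _.
- exact: val_dev_unlikely.
- exact: pay_dev_unlikely.
- exact: est_dev_unlikely outcome_rwd _ _.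
- exact: est_dev_unlikely outcome_rwd _ _.
- exact: est_dev_unlikely outcome_cst _ _.
- exact: est_dev_unlikely outcome_cst _ _.
Qed.

Lemma est_dev_abs f k w : ~ est_dev f 1 k w -> ~ est_dev f (-1) k w ->
  `|\sum_(1 <= j < k.+2) (f (V k.+2 w) (Pb j w) - avg f (V k.+2 w))|
    <= vbar * Num.sqrt (24 * (k.+1%:R * L)).
Proof.
rewrite /est_dev /exceeds /=.
under eq_bigr do rewrite mul1r.
move=> /negP; rewrite -ltNge => h1.
under eq_bigr do rewrite mulN1r.
rewrite sumrN => /negP; rewrite -ltNge => h2.
by rewrite ler_norml; apply/andP; split; lra.
Qed.

Lemma regret_off_bad w : (forall i, (i < T)%N -> ~ bad i w) ->
  T%:R * val - ogd_revenue true vbar rho T (V ^~ w) (Pb ^~ w)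
    <= regret_const vbar rho * Num.sqrt (T%:R * L).
Proof.
move=> good.
have [b1 [b2 [b3 b4]]] : ~ play_dev (@rwd R) (-1) w /\ ~ play_dev (@Defs.cst R) 1 w
    /\ ~ val_dev w /\ ~ pay_dev w.
  by have := good 0%N T0; rewrite /bad /= => h; tauto.
have est f t : outcome_fun f ->
    (forall k, (k.+1 < T)%N -> ~ est_dev f 1 k w /\ ~ est_dev f (-1) k w) ->
    (1 < t <= T)%N ->
    `|\sum_(1 <= j < t) (f (V t w) (Pb j w) - avg f (V t w))|
    <= vbar * Num.sqrt (24 * (t.-1%:R * L)).
  move=> fP h; case: t => [|[|k]] // /andP[_ kT].
  by have [h1 h2] := h k kT; exact: est_dev_abs.
have /andP[val0 val1] := pol_value_bound outcome_rwd.
rewrite /ogd_revenue.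
apply: (pathwise_regret (pr := r) (pc := c) (pol := pol) (gam := gam) vbar0 rho0 rho_le
  (V_bound ^~ w) (P_bound ^~ w) T4 pol_bound) => //.
- by move=> t; exact: avg_ge0 outcome_rwd _.
- by move=> t; rewrite avg_ge0 ?avg_le //; [exact: outcome_cst.. | exact: outcome_cst].
- move=> t; apply: est; first exact: outcome_rwd.
  by move=> k kT; have := good _ kT; rewrite /bad /= => h; tauto.
- move=> t; apply: est; first exact: outcome_cst.
  by move=> k kT; have := good _ kT; rewrite /bad /= => h; tauto.
- apply: le_trans (ltW _); last by move/negP: b1; rewrite -ltNge; apply.
  by apply: ler_sum => t _; rewrite /round_rwd; lra.
- apply: le_trans (ltW _); last by move/negP: b2; rewrite -ltNge; apply.
  by apply: ler_sum => t _; rewrite /round_cst; lra.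
- apply: le_trans (ltW _); last by move/negP: b3; rewrite -ltNge; apply.
  by apply: ler_sum => t _; rewrite /round_val; lra.
rewrite mulrA; apply: le_trans (ltW _); last by move/negP: b4; rewrite -ltNge; apply.
by apply: ler_sum => t _; rewrite /round_pay; lra.
Qed.

(** The complement of [T] groups of four events of probability at most [T ^ -3], so the failure
    probability is at most [4 / T ^ 2], below the allowed [4 / T]. *)
Lemma good_event : exists E : set Omega,
  [/\ measurable E,
    forall w, E w -> T%:R * val - ogd_revenue true vbar rho T (V ^~ w) (Pb ^~ w)
      <= regret_const vbar rho * Num.sqrt (T%:R * L)
  & ((1 - 4 / T%:R)%:E <= P E)%E].
Proof.
have [mB PB] := unlikely_bigU bad_unlikely.
exists (~` \bigcup_(i < T) bad i); split.
- exact: measurableC.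
- move=> w Ew; apply: regret_off_bad => i iT bi; apply: Ew.
  by exists i.
rewrite probability_setC // EFinB; apply: leeB => //.
apply: (le_trans PB); rewrite lee_fin.
have Tp : 0 < T%:R :> R by rewrite ltr0n.
have -> : q = (T%:R ^+ 3)^-1.
  by rewrite /q expRN expRM_natl lnK // posrE.
have -> : T%:R * ((T%:R ^+ 3)^-1 + (T%:R ^+ 3)^-1 + (T%:R ^+ 3)^-1 + (T%:R ^+ 3)^-1)
    = 4 / T%:R / T%:R :> R by field; rewrite gt_eqF.
rewrite ler_pdivrMr //; apply: ler_peMr; last by rewrite ler1n.
by rewrite divr_ge0 // ltW.
Qed.

End GoodEvent.

(** * Comparison with the fluid benchmark *)

Lemma fluid_integral (f : R -> R -> R) (pol : R -> R) :
  outcome_fun f -> measurable_fun setT pol -> (forall x, 0 <= pol x <= 1) ->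
  (\int[F]_x ((pol x)%:E * \int[G]_y (f x y)%:E) = (pol_value pol f)%:E)%E.
Proof.
move=> fP mpol pb; have oT : (1 <= 1 <= T)%N by rewrite T0.
transitivity (\int[F]_x (pol x * avg f x)%:E)%E.
  by apply: eq_integral => x _; rewrite avgE.
have i1 := integrable_pol_avg mpol pb fP 1%N.
rewrite -(law_integral (mV 1) (measurable_pol_avg mpol fP) i1 (V_law oT)).
by rewrite /pol_value /Rintegral fineK //; exact: (integrable_fin_num measurableT i1).
Qed.

Lemma near_optimal_policy : exists pol : R -> R,
  [/\ measurable_fun setT pol, forall x, 0 <= pol x <= 1,
    pol_value pol (@Defs.cst R) <= rho
  & (fluid_opt vbar rho T F G <= (T%:R * pol_value pol (@rwd R) + 1)%:E)%E].
Proof.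
rewrite /fluid_opt; set S := [set _ | _ in _].
have SP y : S y -> exists pol : R -> R, [/\ measurable_fun setT pol,
    forall x, 0 <= pol x <= 1, pol_value pol (@Defs.cst R) <= rho
    & y = (pol_value pol (@rwd R))%:E].
  move=> [pol [mpol [pb gr]] <-]; exists pol; split => //.
    by rewrite -lee_fin -fluid_integral //; exact: outcome_cst.
  exact: fluid_integral outcome_rwd mpol pb.
have S0 : S (\int[F]_x ((0 : R)%:E * \int[G]_y (rwd x y)%:E))%E.
  exists (fun=> 0) => //; split => //; split; first by move=> x; rewrite lexx ler01.
  under eq_integral do rewrite mul0e.
  by rewrite integral0 lee_fin ltW.
(* Finiteness is needed to approach the supremum within [1 / T]: the zero policy bounds it below and
   [vbar] above. *)
have supfin : ereal_sup S \is a fin_num.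
  rewrite fin_numElt; apply/andP; split.
    apply: (@lt_le_trans _ _ (\int[F]_x ((0 : R)%:E * \int[G]_y (rwd x y)%:E))%E).
      by have [pol [_ _ _ ->]] := SP _ S0; rewrite ltNyr.
    exact: ereal_sup_ubound.
  apply: (@le_lt_trans _ _ vbar%:E); last exact: ltry.
  apply: ge_ereal_sup => y /SP[pol [mpol pb _ ->]].
  by have /andP[_ h] := pol_value_bound mpol pb outcome_rwd; rewrite lee_fin.
have Tp : 0 < T%:R :> R by rewrite ltr0n.
have Ti : 0 < (T%:R)^-1 :> R by rewrite invr_gt0.
have [y /SP[pol [mpol pb gr ->]] close] := ub_ereal_sup_adherent Ti supfin.
exists pol; split => //.
move: close; rewrite -(fineK supfin) -EFinB lte_fin -EFinM lee_fin => close.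
have -> : T%:R * pol_value pol (@rwd R) + 1 = T%:R * (pol_value pol (@rwd R) + T%:R^-1).
  by rewrite mulrDr divff // gt_eqF.
by rewrite ler_pM2l //; lra.
Qed.

End Model.

Theorem theorem4 (R : realType) (vbar rho : R) :
  0 < vbar -> 0 < rho -> rho <= vbar ->
  exists C : R,
  forall (T : nat) (d : measure_display) (Omega : measurableType d)
    (P : probability Omega R) (V Pb : nat -> Omega -> R)
    (F G : probability R R),
    (0 < T)%N ->
    (forall t, measurable_fun setT (V t)) ->
    (forall t, measurable_fun setT (Pb t)) ->
    (forall t w, 0 <= V t w <= vbar) ->
    (forall t w, 0 <= Pb t w <= vbar) ->
    (forall t, (1 <= t <= T)%N -> has_law P (V t) F) ->
    (forall t, (1 <= t <= T)%N -> has_law P (Pb t) G) ->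
    mutually_indep P
      (fun (ib : 'I_T * bool) =>
         if ib.2 then Pb (ib.1).+1 else V (ib.1).+1) ->
    exists E : set Omega, measurable E /\
      (forall w, E w ->
        (fluid_opt vbar rho T F G
          - (ogd_revenue true vbar rho T (V ^~ w) (Pb ^~ w))%:E
          <= (C * Num.sqrt (T%:R * ln (T%:R)))%:E)%E) /\
      ((1 - 4 / T%:R)%:E <= P E)%E.
Proof.
(* The extra 1 pays for the suboptimality of the chosen policy, at most 1 over the whole horizon,
   since [T * ln T >= 1] once [T > 4]. *)
move=> vbar0 rho0 rho_le; exists (regret_const vbar rho + 1).
move=> T d Omega P V Pb F G T0 mV mP V_bound P_bound V_law P_law indep.
have Tp : 0 < T%:R :> R by rewrite ltr0n.
(* For [T <= 4] the required probability is not positive, and the empty event suffices. *)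
have [T4|T4] := leqP T 4.
  exists set0; split => //; split => //.
  rewrite measure0 lee_fin subr_le0 ler_pdivlMr // mul1r.
  by rewrite (ler_nat _ T 4).
have [pol [mpol pb gr opt]] := near_optimal_policy vbar0 rho0 T0 mV mP V_bound P_bound
  V_law P_law.
have [E [mE regretE PE]] := good_event vbar0 rho0 rho_le T0 mV mP V_bound P_bound
  V_law P_law indep mpol pb T4 gr.
exists E; split => //; split => // w /regretE regret_w.
apply: (@le_trans _ _ ((T%:R * pol_value P V Pb pol (@rwd R) + 1)%:E
  - (ogd_revenue true vbar rho T (V ^~ w) (Pb ^~ w))%:E)%E); first exact: leeB.
rewrite -EFinB lee_fin mulrDl mul1r.
have : 1 <= Num.sqrt (T%:R * ln T%:R) :> R.
  have L2 := ln_T_ge R T4.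
  have T5 : 5 <= T%:R :> R by rewrite ler_nat.
  have : Num.sqrt 1 <= Num.sqrt (T%:R * ln T%:R) :> R.
    apply: ler_wsqrtr; have a : 0 <= T%:R - 5 :> R by lra.
    have b : 0 <= ln T%:R - 1 / 2 :> R by lra.
    by have := mulr_ge0 a b; lra.
  by rewrite sqrtr1.
lra.
Qed.
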